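(* Let $\sigma:X^m\to Y^n$ be a proper isometric immersion between Riemannian manifolds with bounded second fundamental form, and let $F_f$ be one of the universal subequations $\{\lambda_k(A)\ge f(r)\}$ or $\{\lambda_1(A)+\dots+\lambda_k(A)\ge f(r)\}$ (with $k\le m$), or their complex analogues. Assume that $f$ satisfies (f1), and let $E_\xi=\overline{\{|p|<\xi(r)\}}$ with $\xi$ satisfying ($\xi$1). If $\widetilde{F_f}\cup\widetilde{E_\xi}$ has the Ahlfors property on $Y$, then $\widetilde{F_f}\cup\widetilde{E_\xi}$ has the Ahlfors property on $X$.
   Context: **Jets.** For a Riemannian manifold $M$ (possibly incomplete), $J^2(M)\to M$ is the 2-jet bundle, split via the Levi-Civita connection as $J^2(M)=\mathbf R\oplus T^*M\oplus \mathrm{Sym}^2(T^*M)$; its points are written $(x,r,p,A)$, and $J^2_xu=(x,u(x),du(x),\nabla^2u(x))$ if $u$ is $C^2$ near $x$. For $F\subset J^2(M)$, $F_x$ is the fiber over $x$, and a set such as $\{|p|\le 1\}$ means the set of all $(x,r,p,A)\in J^2(M)$ satisfying the condition; $\lambda_1(A)\le\lambda_2(A)\le\dots$ are the eigenvalues of $A$ with respect to the metric. Thus $F_f$ and $E_\xi$ are defined by the same formulas on both $X$ and $Y$ (with the same $k$). The complex analogues are defined on almost complex Hermitian manifolds by using the eigenvalues of the Hermitian symmetric part $A^{(1,1)}$ of $A$ in place of those of $A$. $\mathrm{USC}(Z)$ denotes upper semicontinuous functions $Z\to[-\infty,+\infty)$. A test for $u$ at $x$ is a function $\phi$, $C^2$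 near $x$, with $\phi\ge u$ near $x$ and $\phi(x)=u(x)$. For $\Omega\subset M$ open, $u\in F(\Omega)$ if $u\in\mathrm{USC}(\Omega)$ and $J^2_x\phi\in F_x$ for all $x\in\Omega$ and all tests $\phi$ for $u$ at $x$; for $K\subset M$ closed, $u\in F(K)$ means $u\in\mathrm{USC}(K)$ and $u\in F(\mathrm{Int}\,K)$. The Dirichlet dual is $\widetilde F=-(\sim\mathrm{Int}\,F)$, i.e. $(x,r,p,A)\in\widetilde F$ iff $(x,-r,-p,-A)\notin\mathrm{Int}\,F$. (f1): $f\in C(\mathbb R)$ is non-decreasing, $f(0)=0$, $f(r)<0$ for $r<0$. ($\xi$1): $\xi\in C(\mathbb R)$ is non-increasing, $\xi(0)=0$, $\xi(r)>0$ for $r<0$. **Ahlfors property** of $G\subset J^2(M)$ on $M$: setting $H=G\cup\{r\le0\}$, for each open $U\subset M$ with non-empty boundary and each $u\in H(\overline U)$ bounded from above and positive somewhere, $\sup_{\partial U}u^+=\sup_{\overline U}u$, where $u^+=\max\{u,0\}$.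
   Formalization: For the complex analogues, the isometric immersion is also assumed to be compatible with the almost complex structures (its differential intertwines J on X and J on Y); without this the complex claim is false. *)

(* Defs.v *)
From HB Require Import structures.
From mathcomp Require Import all_boot all_order all_algebra.
From mathcomp Require Import all_classical all_reals all_analysis.

Set Implicit Arguments.
Unset Strict Implicit.
Unset Printing Implicit Defensive.

Import Order.TTheory GRing.Theory Num.Theory.
Import numFieldNormedType.Exports.

Local Open Scope classical_set_scope.
Local Open Scope ring_scope.

(* Vectors are row vectors: a matrix D acts as v |-> v *m D, as for the       *)
(* library's jacobian, and a bilinear form B is (v, w) |-> v B w^T.           *)

Section Calculus.
Context {R : realType}.

(* In finite dimension, existence and continuity of all iterated directional *)
(* derivatives up to order k on the open set U is the usual C^k regularity.   *)
Fixpoint Ck_on (V W : normedModType R) (k : nat) (U : set V) (f : V -> W)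
    : Prop :=
  (forall x, U x -> {for x, continuous f}) /\
  if k is k'.+1 then
    forall v : V, (forall x, U x -> derivable f x v) /\
                  Ck_on k' U (fun x => 'D_v f x)
  else True.

Definition smooth_on (V W : normedModType R) (U : set V) (f : V -> W) : Prop :=
  forall k, Ck_on k U f.

Definition basis_vec (n : nat) (i : 'I_n) : 'rV[R]_n := delta_mx 0 i.

Definition bil (n : nat) (B : 'M[R]_n) (v w : 'rV[R]_n) : R :=
  (v *m B *m w^T) 0 0.

Definition posdef (n : nat) (B : 'M[R]_n) : Prop :=
  B^T = B /\ forall v : 'rV[R]_n, v != 0 -> 0 < bil B v v.

(* Nondecreasing list, with multiplicity, of the eigenvalues of the symmetric *)
(* form A with respect to the inner product g, i.e. of the g-self-adjoint     *)
(* endomorphism v |-> v *m A *m g^-1.                                         *)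
Definition eigenvalues (n : nat) (g A : 'M[R]_n) : seq R :=
  xget [::] [set s : seq R | sorted <=%R s /\
    char_poly (A *m invmx g) = \prod_(t <- s) ('X - t%:P)].

End Calculus.

Section Manifolds.
Context {R : realType}.

Record chart (T : topologicalType) (n : nat) := Chart {
  cdom : set T ;
  cmap : T -> 'rV[R]_n ;
  cinv : 'rV[R]_n -> T ;
  cdom_open : open cdom ;
  ccod_open : open (cmap @` cdom) ;
  cmapK : forall x, cdom x -> cinv (cmap x) = x ;
  cmap_cont : forall x, cdom x -> {for x, continuous cmap} ;
  cinv_cont : forall y, (cmap @` cdom) y -> {for y, continuous cinv} }.

Definition ccod (T : topologicalType) (n : nat) (a : chart T n)
  : set 'rV[R]_n := cmap a @` cdom a.

(* Smooth manifolds of dimension n. Each point x carries a preferred chart    *)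
(* chart_at x of the atlas; the tangent space at x is 'rV[R]_n, identified    *)
(* through that chart, and all tensors at x are given by their components in  *)
(* that chart.                                                                *)
Record manifold (n : nat) := Manifold {
  mspace :> topologicalType ;
  m_hausdorff : hausdorff_space mspace ;
  m_second_countable : @second_countable mspace ;
  atlas : set (chart mspace n) ;
  atlas_compat : forall a b, atlas a -> atlas b ->
    smooth_on (cmap a @` (cdom a `&` cdom b)) (cmap b \o cinv a) ;
  chart_at : mspace -> chart mspace n ;
  chart_at_atlas : forall x, atlas (chart_at x) ;
  chart_at_dom : forall x, cdom (chart_at x) x }.

(* Matrix of the identity of the tangent space at x, from components in the   *)
(* chart a to components in the preferred chart at x.                         *)
Definition to_preferred (n : nat) (M : manifold n) (a : chart M n) (x : M)
  : 'M[R]_n := jacobian (cmap (chart_at x) \o cinv a) (cmap a x).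

Definition form_in_chart (n : nat) (M : manifold n) (B : M -> 'M[R]_n)
    (a : chart M n) (y : 'rV[R]_n) : 'M[R]_n :=
  let D := to_preferred a (cinv a y) in D *m B (cinv a y) *m D^T.

Definition endo_in_chart (n : nat) (M : manifold n) (E : M -> 'M[R]_n)
    (a : chart M n) (y : 'rV[R]_n) : 'M[R]_n :=
  let D := to_preferred a (cinv a y) in D *m E (cinv a y) *m invmx D.

Record riemannian (n : nat) := Riemannian {
  rman :> manifold n ;
  metric : rman -> 'M[R]_n ;
  metric_posdef : forall x, posdef (metric x) ;
  metric_smooth : forall a, atlas a ->
    smooth_on (ccod a) (form_in_chart metric a) }.

Record almost_hermitian (n : nat) := AlmostHermitian {
  hriem :> riemannian n ;
  acs : hriem -> 'M[R]_n ;
  acs_sq : forall x, acs x *m acs x = - 1%:M ;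
  acs_isometry : forall x, acs x *m metric x *m (acs x)^T = metric x ;
  acs_smooth : forall a, atlas a ->
    smooth_on (ccod a) (endo_in_chart acs a) }.

Definition norm_at (n : nat) (M : riemannian n) (x : M) (v : 'rV[R]_n) : R :=
  Num.sqrt (bil (metric x) v v).

Definition conorm_at (n : nat) (M : riemannian n) (x : M) (p : 'rV[R]_n) : R :=
  Num.sqrt (bil (invmx (metric x)) p p).

(* Christoffel symbols Gamma(v, w) of the Levi-Civita connection at the point *)
(* y of the chart a, as given by Koszul's formula                             *)
(*   2 g(Gamma(v, w), z) = D_v g(w, z) + D_w g(v, z) - D_z g(v, w).           *)
Definition christoffel (n : nat) (M : riemannian n) (a : chart M n)
    (y v w : 'rV[R]_n) : 'rV[R]_n :=
  let G := form_in_chart (@metric n M) a in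
  2^-1 *: (w *m 'D_v G y + v *m 'D_w G y
           - \row_l bil ('D_(basis_vec l) G y) v w) *m invmx (G y).

Definition gradient (n : nat) (M : manifold n) (u : M -> R) (x : M)
    : 'rV[R]_n :=
  let a := chart_at x in
  \row_i 'D_(basis_vec i) (u \o cinv a : 'rV[R]_n -> R) (cmap a x).

Definition hessian (n : nat) (M : riemannian n) (u : M -> R) (x : M)
    : 'M[R]_n :=
  let a := chart_at x in
  let y := cmap a x in
  let f : 'rV[R]_n -> R := u \o cinv a in
  \matrix_(i, j)
    ('D_(basis_vec i) (fun z => 'D_(basis_vec j) f z) y
     - 'D_(christoffel a y (basis_vec i) (basis_vec j)) f y).

Definition C2_near (n : nat) (M : manifold n) (u : M -> R) (x : M) : Prop :=
  let a := chart_at x in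
  exists V : set 'rV[R]_n, [/\ open V, V (cmap a x), V `<=` ccod a &
    Ck_on 2 V (u \o cinv a : 'rV[R]_n -> R)].

End Manifolds.

Arguments chart : clear implicits.
Arguments manifold : clear implicits.
Arguments riemannian : clear implicits.
Arguments almost_hermitian : clear implicits.

Section Jets.
Context {R : realType} {n : nat}.

(* Points (x, r, p, A) of the 2-jet bundle, split by the connection.          *)
Record jet (M : manifold R n) := Jet {
  jpt : M ;
  jval : R ;
  jgrad : 'rV[R]_n ;
  jhess : 'M[R]_n ;
  jhess_sym : jhess^T = jhess }.

(* Bundle coordinates over the chart a. *)
Definition jcoord (M : manifold R n) (a : chart R M n) (j : jet M)
    : 'rV[R]_n * R * 'rV[R]_n * 'M[R]_n :=
  let D := to_preferred a (jpt j) in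
  (cmap a (jpt j), jval j, jgrad j *m D^T, D *m jhess j *m D^T).

(* The total space topology: O is open iff its image in all bundle            *)
(* coordinates is open, relatively to the symmetric matrices.                 *)
Definition jet_open (M : manifold R n) : set_system (jet M) :=
  [set O | forall a, atlas a -> forall j, O j -> cdom a (jpt j) ->
    \forall c \near jcoord a j,
      forall j', cdom a (jpt j') -> jcoord a j' = c -> O j'].

Lemma jet_openT (M : manifold R n) : jet_open [set: jet M].
Proof. by move=> a _ j _ _; apply: filterE. Qed.

Lemma jet_openI (M : manifold R n) : setI_closed (@jet_open M).
Proof.
move=> A B oA oB a aa j [Aj Bj] aj.
apply: filterS2 (oA a aa j Aj aj) (oB a aa j Bj aj).
by move=> c cA cB j' aj' jc; split; [exact: cA | exact: cB].
Qed.

Lemma jet_open_bigU (M : manifold R n) (I : Type) (A : I -> set (jet M)) :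
  (forall i, jet_open (A i)) -> jet_open (\bigcup_i A i).
Proof.
move=> oA a aa j [i _ Aij] aj; apply: filterS (oA i a aa j Aij aj).
by move=> c cA j' aj' jc; exists i => //; exact: cA.
Qed.

HB.instance Definition _ (M : manifold R n) := gen_eqMixin (jet M).
HB.instance Definition _ (M : manifold R n) := gen_choiceMixin (jet M).
HB.instance Definition _ (M : manifold R n) :=
  isOpenTopological.Build (jet M)
    (@jet_openT M) (@jet_openI M) (@jet_open_bigU M).

Lemma jet_opp_sym (M : manifold R n) (j : jet M) : (- jhess j)^T = - jhess j.
Proof. by rewrite linearN /= jhess_sym. Qed.

Definition jet_opp (M : manifold R n) (j : jet M) : jet M :=
  Jet (jpt j) (- jval j) (- jgrad j) (jet_opp_sym j).

Definition dirichlet_dual (M : manifold R n) (F : set (jet M)) : set (jet M) :=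
  [set j | ~ F° (jet_opp j)].

(* J^2_x u = j. For u of class C^2 near x there is exactly one such j, since  *)
(* the Hessian is then symmetric.                                             *)
Definition is_jet2 (M : riemannian R n) (u : M -> R) (x : M) (j : jet M)
    : Prop :=
  [/\ jpt j = x, jval j = u x, jgrad j = gradient u x & jhess j = hessian u x].

End Jets.

Section Viscosity.
Context {R : realType} {n : nat}.
Implicit Types (M : riemannian R n).
Local Open Scope ereal_scope.

(* USC(Z), semicontinuity being relative to Z. Functions on Z are given by    *)
(* total functions whose values outside Z are irrelevant.                     *)
Definition usc_on M (Z : set M) (u : M -> \bar R) : Prop :=
  forall x, Z x -> u x < +oo /\
    forall t : R, u x < t%:E -> \forall y \near within Z (nbhs x), u y < t%:E.

Definition is_test M (u : M -> \bar R) (x : M) (phi : M -> R) : Prop :=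
  [/\ C2_near phi x, \forall y \near x, u y <= (phi y)%:E & (phi x)%:E = u x].

(* F(Omega), for Omega open *)
Definition subharmonic M (F : set (jet M)) (Omega : set M) (u : M -> \bar R)
    : Prop :=
  usc_on Omega u /\
  forall x, Omega x -> forall phi, is_test u x phi ->
    exists2 j, F j & is_jet2 phi x j.

(* F(K), for K closed *)
Definition subharmonic_closed M (F : set (jet M)) (K : set M)
    (u : M -> \bar R) : Prop :=
  usc_on K u /\ subharmonic F K° u.

Definition ahlfors M (G : set (jet M)) : Prop :=
  let H := G `|` [set j | (jval j <= 0)%R] in
  forall U : set M, open U ->
  let bU := closure U `\` U in
  bU !=set0 ->
  forall u : M -> \bar R, subharmonic_closed H (closure U) u ->
  (exists C : R, forall x, closure U x -> u x <= C%:E) ->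
  (exists2 x, closure U x & 0 < u x) ->
  ereal_sup [set maxe (u x) 0 | x in bU] = ereal_sup [set u x | x in closure U].

End Viscosity.

Section Subequations.
Context {R : realType} {n : nat}.

Definition cond_f1 (f : R -> R) : Prop :=
  [/\ continuous f, {homo f : r s / r <= s}, f 0 = 0
    & forall r, r < 0 -> f r < 0].

Definition cond_xi1 (xi : R -> R) : Prop :=
  [/\ continuous xi, {homo xi : r s / r <= s >-> s <= r}, xi 0 = 0
    & forall r, r < 0 -> 0 < xi r].

Variant spectral_kind := KthEigenvalue | SumOfFirstK.

(* lambda_k or lambda_1 + ... + lambda_k, eigenvalues being numbered from 1 *)
Definition spectral_fun (b : spectral_kind) (k : nat) (s : seq R) : R :=
  match b with
  | KthEigenvalue => s`_k.-1
  | SumOfFirstK => \sum_(i < k) s`_i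
  end.

Definition F_real (M : riemannian R n) (b : spectral_kind) (k : nat)
    (f : R -> R) : set (jet M) :=
  [set j | f (jval j)
           <= spectral_fun b k (eigenvalues (metric (jpt j)) (jhess j))].

(* A^(1,1) : (v, w) |-> (A(v, w) + A(Jv, Jw)) / 2, as a real symmetric form.  *)
(* Each of its Hermitian eigenvalues thus occurs twice in eigenvalues g _.    *)
Definition hermitian_part (J A : 'M[R]_n) : 'M[R]_n :=
  2^-1 *: (A + J *m A *m J^T).

(* k ranges over the n eigenvalues of the real form A^(1,1), so that the k-th *)
(* Hermitian eigenvalue is the eigenvalue of index 2k.                        *)
Definition F_complex (M : almost_hermitian R n) (b : spectral_kind) (k : nat)
    (f : R -> R) : set (jet M) :=
  [set j | f (jval j)
           <= spectral_fun b k (eigenvalues (metric (jpt j))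
                                  (hermitian_part (acs (jpt j)) (jhess j)))].

Definition E_xi (M : riemannian R n) (xi : R -> R) : set (jet M) :=
  closure [set j : jet M | conorm_at (jpt j) (jgrad j) < xi (jval j)].

End Subequations.

Arguments F_real {R n} M b k f.
Arguments F_complex {R n} M b k f.
Arguments E_xi {R n} M xi.

Section Immersions.
Context {R : realType} {m n : nat}.

Definition in_charts (X : manifold R m) (Y : manifold R n) (s : X -> Y)
    (a : chart R X m) (b : chart R Y n) : 'rV[R]_m -> 'rV[R]_n :=
  fun z => cmap b (s (cinv a z)).

Definition smooth_map (X : manifold R m) (Y : manifold R n) (s : X -> Y)
    : Prop :=
  continuous s /\
  forall a b, atlas a -> atlas b ->
    smooth_on (cmap a @` (cdom a `&` s @^-1` cdom b)) (in_charts s a b).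

Definition proper_map (X : manifold R m) (Y : manifold R n) (s : X -> Y)
    : Prop :=
  forall K : set Y, compact K -> compact (s @^-1` K).

Definition differential (X : manifold R m) (Y : manifold R n) (s : X -> Y)
    (x : X) : 'M[R]_(m, n) :=
  jacobian (in_charts s (chart_at x) (chart_at (s x))) (cmap (chart_at x) x).

Definition isometric_immersion (X : riemannian R m) (Y : riemannian R n)
    (s : X -> Y) : Prop :=
  [/\ smooth_map s, forall x, row_free (differential s x)
    & forall x, let D := differential s x in
        D *m metric (s x) *m D^T = metric x].

(* II(v, w) = nabla^Y_v ds(W) - ds(nabla^X_v W), for W extending w by         *)
(* constant components in the chart at x.                                     *)
Definition second_fundamental_form (X : riemannian R m) (Y : riemannian R n)
    (s : X -> Y) (x : X) (v w : 'rV[R]_m) : 'rV[R]_n :=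
  let a := chart_at x in
  let b := chart_at (s x) in
  let y := cmap a x in
  let sigma := in_charts s a b in
  'D_v (fun z => 'D_w sigma z) y
  + christoffel b (cmap b (s x)) ('D_v sigma y) ('D_w sigma y)
  - 'D_(christoffel a y v w) sigma y.

Definition bounded_second_fundamental_form (X : riemannian R m)
    (Y : riemannian R n) (s : X -> Y) : Prop :=
  exists C : R, forall (x : X) (v w : 'rV[R]_m),
    norm_at (s x) (second_fundamental_form s x v w)
    <= C * norm_at x v * norm_at x w.

(* ds o J_X = J_Y o ds *)
Definition almost_complex_map (X : almost_hermitian R m)
    (Y : almost_hermitian R n) (s : X -> Y) : Prop :=
  forall x, acs x *m differential s x = differential s x *m acs (s x).

End Immersions.

(* Main.v *)
From HB Require Import structures.
From mathcomp Require Import all_boot all_order all_algebra.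
From mathcomp Require Import all_classical all_reals all_analysis.
From mathcomp Require Import ring lra.
Require Import Defs.

Set Implicit Arguments.
Unset Strict Implicit.
Unset Printing Implicit Defensive.

Import Order.TTheory GRing.Theory Num.Theory.
Import numFieldNormedType.Exports.

Local Open Scope classical_set_scope.
Local Open Scope ring_scope.

(** The Ahlfors property is transported directly: a violation on X is pushed
    forward to a violation on Y.

    Let u violate it on an open set U of X, let S be the supremum of u and let
    c be slightly less than S but larger than the supremum of u^+ over the
    boundary of U. The function v(y) = max(0, max {u(x) - c : x in U,
    sigma(x) = y}) on Y takes its values in [0, e], where e = S - c. Since
    sigma is proper, the maximum over a fibre is attained and v is upper
    semicontinuous (fiber_sup_attained, fiber_sup_usc). If phi tests v at y,
    v(y) > 0 and x is a maximum point over y, then phi o sigma + c tests u at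
    x, so that its 2-jet lies in the dual set on X, at a value above c. There,
    with p = d(phi o sigma) and A = Hess(phi o sigma), either |p| >= xi(-c), or
    the spectral function of -A is at most f(-c) < 0. Both bounds stay away
    from 0 as e tends to 0, whereas membership in the dual set on Y at the
    value v(y) <= e only asks for bounds that tend to 0 with e. This slack
    absorbs the second fundamental form (jet_transfer). Indeed
    |d(phi o sigma)| <= |dphi|, and
      Hess(phi o sigma) = sigma^* Hess(phi) + dphi(II)
    (pullback_hessian); when |dphi| <= xi(-2e) the last term is O(xi(-2e)), and
    restricting a quadratic form to a subspace does not decrease its k-th
    eigenvalue or the sum of its k lowest ones (spectral_fun_congr). Hence v is
    a subsolution on all of Y. The Ahlfors property of Y on the complement of
    one point p gives sup v <= v(p) (ahlfors_global_constant), so v is a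
    positive constant; but the jet of a positive constant is not in the dual
    set.

    The real and the complex case are one statement about a field J of
    isometric endomorphisms that commutes with the differential of sigma: J is
    the almost complex structure, or the identity, for which the Hermitian part
    of A is A itself (F_twisted, ahlfors_pullback).

    Eigenvalues enter through one device. A strict lower bound t for the
    spectral function of A with respect to g is equivalent to the existence of
    a certificate (spectral_cert): finitely many quadratic forms, affine in g
    and A, are positive definite. Such a condition is open in (g, A), is
    inherited by restrictions to subspaces, and is easy to follow under
    perturbations of A, which gives the three properties of the spectral
    function that the argument uses. *)

(** * Directional derivatives and differentiability *)

Section Directional.
Context {R : realType} {V : normedModType R}.
Implicit Types (f : V -> R) (x v : V).

Lemma is_derive_line (W : normedModType R) (f : V -> W) x v t :
  derivable f (x + t *: v) v ->
  is_derive t 1 (fun s : R => f (x + s *: v)) ('D_v f (x + t *: v)).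
Proof.
have E : (fun h : R =>
  h^-1 *: (((fun s : R => f (x + s *: v)) \o shift t) (h *: 1)
    - f (x + t *: v))) =
  (fun h : R => h^-1 *: ((f \o shift (x + t *: v)) (h *: v) - f (x + t *: v))).
  apply/funext => h /=; congr (_ *: (f _ - _)).
  by rewrite -[h%:A]/(h * 1) mulr1 scalerDl addrCA.
move=> df; split; first by rewrite /derivable E.
by rewrite /derive E.
Qed.

(** Homogeneity in the direction, the chain rule for s |-> f (x + s v);
    additivity in the direction is not automatic and needs differentiability. *)
Lemma is_deriveZv (f : V -> R) x v a :
  derivable f x v -> is_derive x (a *: v) f (a * 'D_v f x).
Proof.
move=> df.
have df' : derivable f (x + 0 *: v) v by rewrite scale0r addr0.
have g1 := is_derive_line df'.
have gd : differentiable (fun s : R => f (x + s *: v)) 0.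
  by apply/derivable1_diffP; case: g1.
have E : (fun h : R => h^-1 *: ((f \o shift x) (h *: (a *: v)) - f x)) =
  (fun h : R => h^-1 *: (((fun s : R => f (x + s *: v)) \o shift 0) (h *: a)
     - (fun s : R => f (x + s *: v)) 0)).
  apply/funext => h /=; rewrite scale0r !addr0 scalerA -[h *: a]/(h * a).
  by rewrite [x + _]addrC.
have E2 : 'D_(a *: v) f x = 'D_a (fun s : R => f (x + s *: v)) 0.
  by rewrite /derive E.
split; first by rewrite /derivable E; exact: diff_derivable gd.
rewrite E2 deriveE // -[a in LHS]mulr1 [LHS]linearZ/= -deriveE //.
by case: g1 => _; rewrite scale0r addr0 => ->.
Qed.

Lemma MVT_dir f x v : (forall t, 0 <= t <= 1 -> derivable f (x + t *: v) v) ->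
  exists2 t, 0 <= t <= 1 & f (x + v) - f x = 'D_v f (x + t *: v).
Proof.
move=> df.
have [||t] := @MVT_segment R (fun s : R => f (x + s *: v))
   (fun t => 'D_v f (x + t *: v)) 0 1 ler01.
- move=> t; rewrite in_itv /= => /andP[t0 t1]; apply: is_derive_line.
  by apply: df; rewrite !ltW.
- apply/continuous_in_subspaceT => t; rewrite inE/= in_itv/= => t01.
  apply: differentiable_continuous; apply/derivable1_diffP.
  by have [] := is_derive_line (df _ t01).
- rewrite in_itv /= => t01 E; exists t => //.
  by move: E; rewrite scale1r scale0r addr0 subr0 mulr1.
Qed.

End Directional.

Lemma linear_approx_differentiable (R : realType) (V W : normedModType R)
    (f L : V -> W) x :
  linear L -> continuous L ->
  (forall e, 0 < e ->
    \forall h \near 0, `|f (h + x) - (f x + L h)| <= e * `|h|) ->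
  differentiable f x.
Proof.
move=> Llin Lc fL.
pose LL : {linear V -> W} := HB.pack L (GRing.isLinear.Build _ _ _ _ L Llin).
have H : f \o shift x = cst (f x) + LL +o_ 0 id.
  by apply/eqaddoP => e e0; exact: fL.
have dE : 'd f x = LL :> (V -> W) by apply: diff_unique H.
by apply/diff_locallyP; rewrite dE; split.
Qed.

Section Coordinates.
Context {R : realType}.

Lemma mx_entry_le m n (A : 'M[R]_(m, n)) i j : `|A i j| <= `|A|.
Proof.
by rewrite [leRHS]/Num.Def.normr/= mx_normrE; exact: (le_bigmax _ _ (i, j)).
Qed.

Lemma mx_norm_le m n (A : 'M[R]_(m, n)) e :
  0 <= e -> (forall i j, `|A i j| <= e) -> `|A| <= e.
Proof.
move=> e0 Ae; rewrite [leLHS]/Num.Def.normr/= mx_normrE.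
by apply: bigmax_le => // -[i j] _ /=.
Qed.

Lemma mx_continuousP (T : topologicalType) m n (f : T -> 'M[R]_(m, n)) x :
  (forall i j, {for x, continuous (fun y => f y i j)}) <->
  {for x, continuous f}.
Proof.
split=> [fc|fc i j]; last first.
  exact: (@continuous_comp _ _ _ f (fun A : 'M[R]_(m, n) => A i j) x fc
           (@coord_continuous _ _ _ i j (f x))).
move=> A [P Pf PA].
have H : \forall y \near x, forall ij : 'I_m * 'I_n,
  P ij.1 ij.2 (f y ij.1 ij.2).
  by apply: filter_forall => -[i j]; exact: (fc i j _ (Pf i j)).
by apply: filterS H => y Hy; apply: PA => i j; exact: (Hy (i, j)).
Qed.

Lemma continuous_at_sum (T : topologicalType) (I : finType)
  (F : I -> T -> R) x :
  (forall i, {for x, continuous (F i)}) ->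
  {for x, continuous (fun y => \sum_i F i y)}.
Proof.
move=> Fc; apply: (@cvg_big R I +%R 0 xpredT _ T (nbhs x) _ F (F^~ x)) =>
  [|i _].
  exact: add_continuous.
exact: Fc.
Qed.

Lemma continuous_atM (T : topologicalType) (f g : T -> R) x :
  {for x, continuous f} -> {for x, continuous g} ->
  {for x, continuous (fun y => f y * g y)}.
Proof. by move=> fc gc; exact: cvgM. Qed.

Lemma continuous_atD (T : topologicalType) (f g : T -> R) x :
  {for x, continuous f} -> {for x, continuous g} ->
  {for x, continuous (fun y => f y + g y)}.
Proof. by move=> fc gc; exact: cvgD. Qed.

Lemma continuous_at_cst (T U : topologicalType) (a : U) (x : T) :
  {for x, continuous (fun=> a)}.
Proof. exact: cvg_cst. Qed.

Lemma row_sum_basis n (v : 'rV[R]_n) : v = \sum_i v 0 i *: basis_vec i.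
Proof. exact: row_sum_delta. Qed.

(** The points x + row_prefix h k, for k = 0, ..., n, lead from x to x + h by
    steps parallel to the axes. *)
Definition row_prefix n (h : 'rV[R]_n) (k : nat) : 'rV[R]_n :=
  \row_i (if (i < k)%N then h 0 i else 0).

(** On each step of the path from x to x + h that is parallel to an axis, the
    mean value theorem turns the increment of f into a partial derivative at a
    point close to x, and continuity of the partial derivatives bounds its
    distance to the partial derivative at x. *)
Lemma C1_differentiable n (f : 'rV[R]_n -> R) (U : set 'rV[R]_n) x :
  open U -> U x -> (forall v y, U y -> derivable f y v) ->
  (forall v, {for x, continuous (fun y => 'D_v f y)}) -> differentiable f x.
Proof.
move=> oU Ux df cdf.
pose L (h : 'rV[R]_n) : R := \sum_i h 0 i * 'D_(basis_vec i) f x.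
have Llin : linear L.
  move=> a u v; rewrite /L scaler_sumr -big_split /=; apply: eq_bigr => i _.
  by rewrite !mxE mulrDl -[_ *: _]/(_ * _) mulrA.
have Lc : continuous L.
  move=> h; rewrite /L.
  apply: (@continuous_at_sum 'rV[R]_n 'I_n
    (fun i h => h 0 i * 'D_(basis_vec i) f x) h) => i.
  apply: (@continuous_atM 'rV[R]_n (fun h => h 0 i)).
    exact: (@coord_continuous R 1 n 0 i h).
  exact: continuous_at_cst.
apply: (linear_approx_differentiable Llin Lc) => _/posnumP[e].
  have n1 : 0 < n.+1%:R :> R by [].
  have e'0 : 0 < e%:num / n.+1%:R by rewrite divr_gt0.
  have : \forall y \near x, U y /\
      forall i : 'I_n, `|'D_(basis_vec i) f x - 'D_(basis_vec i) f y|
        <= e%:num / n.+1%:R.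
    apply: filterI; first exact: open_nbhs_nbhs.
    have D (i : 'I_n) : \forall y \near x,
        `|'D_(basis_vec i) f x - 'D_(basis_vec i) f y| <= e%:num / n.+1%:R.
      by have /cvgrPdist_le := cdf (basis_vec i); apply.
    exact: (filter_forall (nbhs_filter x) D).
  move=> /nbhs_normP[d /= d0 Hd].
  apply/nbhs_normP; exists d => // h /=; rewrite sub0r normrN => hd.
  have tr_le t (i : 'I_n) : 0 <= t <= 1 ->
      `|row_prefix h i + t *: (h 0 i *: basis_vec i)| <= `|h|.
    move=> /andP[t0 t1]; apply: mx_norm_le => // a j; rewrite !mxE ord1 eqxx /=.
    have [->|ji] := eqVneq j i.
      rewrite ltnn add0r mulr1 normrM ger0_norm //.
      by rewrite -[leRHS]mul1r ler_pM // mx_entry_le.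
    by rewrite !mulr0 addr0; case: ifP => _; rewrite ?normr0 // mx_entry_le.
  have trn : row_prefix h n = h by apply/rowP => i; rewrite mxE ltn_ord.
  have tr0 : row_prefix h 0 = 0 by apply/rowP => i; rewrite !mxE.
  have trS (i : 'I_n) : row_prefix h i.+1 =
    row_prefix h i + h 0 i *: basis_vec i.
    apply/rowP => j; rewrite !mxE eqxx /= ltnS leq_eqVlt.
    have [->|ji] := eqVneq j i; first by rewrite eqxx ltnn /= mulr1 add0r.
    by rewrite -val_eqE in ji; rewrite (negPf ji) /= mulr0 addr0.
  have -> : f (h + x) - (f x + L h) =
      \sum_(i < n) (f (x + row_prefix h i.+1) - f (x + row_prefix h i) - h 0 i
        * 'D_(basis_vec i) f x).
    rewrite sumrB opprD addrA; congr (_ - _).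
    rewrite -(big_mkord xpredT (fun i => f (x + row_prefix h i.+1) - f
      (x + row_prefix h i))).
    by rewrite (telescope_sumr (fun k => f (x + row_prefix h k))) // trn tr0
      addr0 [h + x]addrC.
  rewrite (le_trans (ler_norm_sum _ _ _)) //.
  apply: (@le_trans _ _ (\sum_(i < n) e%:num / n.+1%:R * `|h|)); last first.
    rewrite sumr_const card_ord -mulrnAl; apply: ler_wpM2r => //.
    by rewrite -mulrnAl -mulr_natr ler_pdivrMr // ler_wpM2l // ler_nat.
  apply: ler_sum => i _.
  have inU t : 0 <= t <= 1 ->
    `|x - (x + row_prefix h i + t *: (h 0 i *: basis_vec i))| < d.
    move=> t01; rewrite -addrA opprD addrA subrr sub0r normrN.
    by rewrite (le_lt_trans _ hd) // tr_le.
  have [t t01|t t01] := @MVT_dir _ _ f (x + row_prefix h i)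
    (h 0 i *: basis_vec i).
    have [dU _] := Hd _ (inU t t01).
    exact: df.
  rewrite trS addrA => ->.
  have [dU dD] := Hd _ (inU t t01).
  have := is_deriveZv (h 0 i) (df (basis_vec i) _ dU) => /@derive_val ->.
  rewrite -mulrBr normrM mulrC ler_pM // ?mx_entry_le // distrC.
  exact: dD.
Qed.

End Coordinates.

(** * Functions of class C^k *)

Section CkGeneral.
Context {R : realType} {V W : normedModType R}.
Implicit Types (f g : V -> W) (U : set V).

Lemma Ck_on_continuous k U f x : Ck_on k U f -> U x -> {for x, continuous f}.
Proof. by case: k => [|k] [fc _] Ux; exact: fc. Qed.

Lemma Ck_on_derivable k U f v x : Ck_on k.+1 U f -> U x -> derivable f x v.
Proof. by move=> [_ /(_ v) [df _]] Ux; exact: df. Qed.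

Lemma Ck_on_derive k U f v : Ck_on k.+1 U f -> Ck_on k U (fun x => 'D_v f x).
Proof. by move=> [_ /(_ v) []]. Qed.

Lemma Ck_onW k U f : Ck_on k.+1 U f -> Ck_on k U f.
Proof.
elim: k f => [|k IHk] f [fc fd]; first by split.
split=> // v; have [df cdf] := fd v; split => //; exact: IHk.
Qed.

Lemma Ck_on_sub k U U' f : U' `<=` U -> Ck_on k U f -> Ck_on k U' f.
Proof.
move=> sU; elim: k f => [|k IHk] f [fc fd].
  by split=> // x /sU; exact: fc.
split=> [x /sU|v]; first exact: fc.
by have [df cdf] := fd v; split => [x /sU|]; [exact: df|exact: IHk].
Qed.

Lemma near_eq_continuous_at f g x :
  (\forall y \near x, f y = g y) -> {for x, continuous f} ->
    {for x, continuous g}.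
Proof.
move=> fg fc; have fgx := nbhs_singleton fg.
rewrite /prop_for /continuous_at -fgx; apply: cvg_trans fc; exact: near_eq_cvg.
Qed.

Lemma near_open U (P : V -> Prop) x : open U -> U x -> (forall y, U y -> P y) ->
  \forall y \near x, P y.
Proof. by move=> oU Ux UP; apply: filterS UP _; exact: open_nbhs_nbhs. Qed.

Lemma Ck_on_eq k U f g : open U -> (forall x, U x -> f x = g x) ->
  Ck_on k U f -> Ck_on k U g.
Proof.
move=> oU; elim: k f g => [|k IHk] f g fg [fc fd].
  split=> // x Ux.
  by apply: near_eq_continuous_at (fc x Ux); exact: near_open fg.
split=> [x Ux|v].
  by apply: near_eq_continuous_at (fc x Ux); exact: near_open fg.
have [df cdf] := fd v; split => [x Ux|].
  by apply: near_eq_derivable (df x Ux); exact: near_open fg.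
apply: IHk cdf => x Ux; apply: near_eq_derive; exact: near_open fg.
Qed.

Lemma Ck_on_cst k U (a : W) : Ck_on k U (fun=> a : W).
Proof.
elim: k a => [|k IHk] a; first by split=> // x _; exact: continuous_at_cst.
split=> [x _|v]; first exact: continuous_at_cst.
split=> [x _|]; first exact: derivable_cst.
suff -> : 'D_v (fun=> a) = (fun=> 0) by [].
by apply/funext => x; exact: derive_cst.
Qed.

Lemma Ck_onD k U f g : open U -> Ck_on k U f -> Ck_on k U g ->
  Ck_on k U (fun x => f x + g x).
Proof.
move=> oU; elim: k f g => [|k IHk] f g [fc fd] [gc gd].
  by split=> // x Ux; apply: cvgD; [exact: fc|exact: gc].
split=> [x Ux|v]; first by apply: cvgD; [exact: fc|exact: gc].
have [df cdf] := fd v; have [dg cdg] := gd v; split=> [x Ux|].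
  by apply: derivableD; [exact: df|exact: dg].
apply: (Ck_on_eq oU) (IHk _ _ cdf cdg) => x Ux.
by rewrite -deriveD //; [exact: df|exact: dg].
Qed.

Lemma Ck_on_sum k U (I : Type) (r : seq I) (F : I -> V -> W) : open U ->
  (forall i, Ck_on k U (F i)) -> Ck_on k U (fun x => \sum_(i <- r) F i x).
Proof.
move=> oU FC; elim: r => [|i r IHr].
  rewrite (_ : (fun _ => _) = (fun=> 0)); first exact: Ck_on_cst.
  by apply/funext => x; rewrite big_nil.
rewrite (_ : (fun _ => _) = (fun x => F i x + \sum_(j <- r) F j x)).
  exact: Ck_onD.
by apply/funext => x; rewrite big_cons.
Qed.

End CkGeneral.

Section CkScalar.
Context {R : realType} {V : normedModType R}.
Implicit Types (f g : V -> R) (U : set V).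

Lemma Ck_onM k U f g : open U -> Ck_on k U f -> Ck_on k U g ->
  Ck_on k U (fun x => f x * g x).
Proof.
move=> oU; elim: k f g => [|k IHk] f g fC gC.
  have [fc fd] := fC; have [gc gd] := gC.
  by split=> // x Ux; apply: continuous_atM; [exact: fc|exact: gc].
have [fc fd] := fC; have [gc gd] := gC.
split=> [x Ux|v]; first by apply: continuous_atM; [exact: fc|exact: gc].
have [df cdf] := fd v; have [dg cdg] := gd v; split=> [x Ux|].
  by apply: derivableM; [exact: df|exact: dg].
apply: (Ck_on_eq oU) (Ck_onD oU (IHk _ _ (Ck_onW fC) cdg)
  (IHk _ _ (Ck_onW gC) cdf)) => x Ux.
by rewrite (deriveM (df x Ux) (dg x Ux)).
Qed.

End CkScalar.

Section CkMatrix.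
Context {R : realType} {V : normedModType R}.

Lemma Ck_on_entry k m n (U : set V) (f : V -> 'M[R]_(m, n)) i j : open U ->
  Ck_on k U f -> Ck_on k U (fun x => f x i j : R).
Proof.
move=> oU; elim: k f => [|k IHk] f [fc fd].
  by split=> // x Ux; have /mx_continuousP := fc x Ux; apply.
split=> [x Ux|v]; first by have /mx_continuousP := fc x Ux; apply.
have [df cdf] := fd v; split=> [x Ux|].
  by have /derivable_mxP := df x Ux; apply.
apply: (Ck_on_eq oU) (IHk _ cdf) => x Ux.
by rewrite (derive_mx (df x Ux)) mxE.
Qed.

End CkMatrix.

Section CkRow.
Context {R : realType}.

Lemma Ck1_differentiable n (U : set 'rV[R]_n) (f : 'rV[R]_n -> R) k x :
  open U -> Ck_on k.+1 U f -> U x -> differentiable f x.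
Proof.
move=> oU fC Ux; apply: (C1_differentiable oU Ux) => [v y|v].
  exact: Ck_on_derivable fC.
exact: Ck_on_continuous (Ck_on_derive _ fC) Ux.
Qed.

Lemma Ck1_differentiable_mx n p q (U : set 'rV[R]_n)
  (f : 'rV[R]_n -> 'M[R]_(p, q)) k x :
  open U -> Ck_on k.+1 U f -> U x -> differentiable f x.
Proof.
move=> oU fC Ux.
have -> : f = fun y => \sum_(ij : 'I_p * 'I_q) f y ij.1 ij.2 *: delta_mx ij.1
  ij.2.
  apply/funext => y; rewrite [LHS]matrix_sum_delta pair_big /=.
  by apply: eq_bigr.
have D (ij : 'I_p * 'I_q) : differentiable
    (fun y => f y ij.1 ij.2 *: delta_mx ij.1 ij.2 : 'M[R]_(p, q)) x.
  apply: differentiableZl;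
    exact: (Ck1_differentiable oU (Ck_on_entry _ _ oU fC)).
elim: (index_enum _) => [|i r IHr].
  rewrite (_ : (fun _ => _) = cst 0); first exact: differentiable_cst.
  by apply/funext => y; rewrite big_nil.
rewrite (_ : (fun _ => _) = (fun y => f y i.1 i.2 *: delta_mx i.1 i.2) +
  (fun y => \sum_(j <- r) f y j.1 j.2 *: delta_mx j.1 j.2)).
  exact: differentiableD.
by apply/funext => y; rewrite big_cons.
Qed.

Lemma derive_sum_basis (W : normedModType R) n (f : 'rV[R]_n -> W) x v :
  differentiable f x ->
  'D_v f x = \sum_i v 0 i *: 'D_(basis_vec i) f x.
Proof.
move=> df; rewrite deriveE // [in LHS](row_sum_basis v) linear_sum.
by apply: eq_bigr => i _; rewrite linearZ deriveE.
Qed.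

Lemma derive_comp (W : normedModType R) m n (g : 'rV[R]_m -> 'rV[R]_n)
    (f : 'rV[R]_n -> W) x v :
  differentiable g x -> differentiable f (g x) ->
  'D_v (f \o g) x = 'D_('D_v g x) f (g x).
Proof.
move=> dg df; have dfg : differentiable
  (f \o g) x by exact: differentiable_comp.
by rewrite !deriveE // diff_comp.
Qed.

(** By induction on k: D_v (f o g) is the sum of the products of the components
    of D_v g with the functions D_i f o g. *)
Lemma Ck_on_comp k m n (U : set 'rV[R]_m) (O : set 'rV[R]_n)
    (g : 'rV[R]_m -> 'rV[R]_n) (f : 'rV[R]_n -> R) :
  open U -> open O -> (forall x, U x -> O (g x)) ->
  Ck_on k U g -> Ck_on k O f -> Ck_on k U (f \o g).
Proof.
move=> oU oO gO; elim: k f => [|k IHk] f gC fC.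
  split=> // x Ux; apply: continuous_comp.
    exact: Ck_on_continuous gC _.
  by apply: Ck_on_continuous fC _; exact: gO.
split=> [x Ux|v].
  apply: continuous_comp; first exact: Ck_on_continuous gC _.
  by apply: Ck_on_continuous fC _; exact: gO.
have dg x : U x -> differentiable g x by exact: Ck1_differentiable_mx gC.
have df y : O y -> differentiable f y by exact: Ck1_differentiable fC.
split=> [x Ux|].
  apply: diff_derivable; apply: differentiable_comp; first exact: dg.
  by apply: df; exact: gO.
apply: (@Ck_on_eq R _ _ k U (fun x => \sum_(i < n)
   ('D_v g x) 0 i * ('D_(basis_vec i) f \o g) x) _ oU).
  move=> x Ux; have dfx := df _ (gO _ Ux).
  by rewrite (derive_comp v (dg _ Ux) dfx) [RHS]derive_sum_basis.
apply: Ck_on_sum => // i; apply: Ck_onM => //.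
  by apply: Ck_on_entry => //; exact: Ck_on_derive gC.
by apply: IHk; [exact: Ck_onW|exact: Ck_on_derive fC].
Qed.

End CkRow.

(** * Second derivatives *)

Section SecondDerivatives.
Context {R : realType}.

Lemma derivable_shift (V W : normedModType R) (f : V -> W) c x v :
  derivable f (x + c) v -> is_derive x v (fun z => f (z + c)) ('D_v f (x + c)).
Proof.
have E : (fun h : R =>
  h^-1 *: (((fun z => f (z + c)) \o shift x) (h *: v) - f (x + c)))
    = (fun h : R => h^-1 *: ((f \o shift (x + c)) (h *: v) - f (x + c))).
  by apply/funext => h /=; rewrite addrA.
by move=> df; split; [rewrite /derivable E | rewrite /derive E].
Qed.

Lemma derive_addc (V : normedModType R) (f : V -> R) c x v :
  'D_v (fun z => f z + c) x = 'D_v f x.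
Proof.
have E : (fun h : R =>
  h^-1 *: (((fun z => f z + c) \o shift x) (h *: v) - (f x + c)))
    = (fun h : R => h^-1 *: ((f \o shift x) (h *: v) - f x)).
  by apply/funext => h /=; rewrite opprD addrACA subrr addr0.
by rewrite /derive E.
Qed.

(** The mean value theorem applied twice, in the direction v to the difference
    f (z + h w) - f z and then in the direction w to D_v f. *)
Lemma second_difference (V : normedModType R) (f : V -> R) U x v w h :
  0 < h -> Ck_on 2 U f ->
  (forall s t, 0 <= s <= 1 -> 0 <= t <= 1 ->
     U (x + s *: (h *: v) + t *: (h *: w))) ->
  exists s t, [/\ 0 <= s <= 1, 0 <= t <= 1 &
    f (x + h *: v + h *: w) - f (x + h *: v) - (f (x + h *: w) - f x) =
    h ^+ 2 * 'D_w (fun z => 'D_v f z) (x + s *: (h *: v) + t *: (h *: w))].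
Proof.
move=> h0 fC inU.
pose phi z := f (z + h *: w) - f z.
have dphi s : 0 <= s <= 1 -> is_derive (x + s *: (h *: v)) (h *: v) phi
   (h * ('D_v f (x + s *: (h *: v) + h *: w) - 'D_v f (x + s *: (h *: v)))).
  move=> s01; have U1 := inU s 1 s01 _; have U0 := inU s 0 s01 _.
  rewrite scale1r in U1; rewrite scale0r addr0 in U0.
  have i01 : is_true (((0 : R) <= 1) && ((1 : R) <= 1)) by rewrite ler01 lexx.
  have i00 : is_true (((0 : R) <= 0) && ((0 : R) <= 1)) by rewrite ler01 lexx.
  have d1 : derivable f (x + s *: (h *: v) + h *: w) v
    by exact: Ck_on_derivable fC (U1 i01).
  have d0 : derivable f (x + s *: (h *: v)) v by exact: Ck_on_derivable fC
    (U0 i00).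
  have [d1' d1E] := derivable_shift d1.
  have := is_deriveB (is_deriveZv h d1') (is_deriveZv h d0).
  by rewrite d1E mulrBr.
have [s s01|s s01 Es] := @MVT_dir _ _ phi x (h *: v).
  by case: (dphi s s01).
have := inU s _ s01; set y := x + _ => inUs.
have d2 t : 0 <= t <= 1 -> is_derive (y + t *: (h *: w)) (h *: w) (fun z =>
  'D_v f z)
   (h * 'D_w (fun z => 'D_v f z) (y + t *: (h *: w))).
  move=> t01; apply: is_deriveZv.
  exact: Ck_on_derivable (Ck_on_derive v fC) (inUs _ t01).
have [t t01|t t01 Et] := @MVT_dir _ _ (fun z => 'D_v f z) y (h *: w).
  by case: (d2 t t01).
exists s, t; split => //.
have D2 := @derive_val _ _ _ _ _ _ _ (d2 t t01).
have D1 := @derive_val _ _ _ _ _ _ _ (dphi s s01).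
by rewrite -/y expr2 -mulrA -D2 -Et -D1 -Es.
Qed.

(** Isolates the passage to the limit in the symmetry of second derivatives. *)
Lemma eq_of_meeting_limits (V : normedModType R) (F1 F2 : V -> R) x :
  {for x, continuous F1} -> {for x, continuous F2} ->
  (forall d, 0 < d ->
    exists y1 y2, [/\ `|x - y1| < d, `|x - y2| < d & F1 y1 = F2 y2]) ->
  F1 x = F2 x.
Proof.
move=> c1 c2 meet; apply/eqP; rewrite -subr_eq0 -normr_le0;
  apply/ler_addgt0Pl => e e0.
rewrite addr0.
have e2 : 0 < e / 2 by rewrite divr_gt0.
move/cvgrPdist_le : c1 => /(_ _ e2) /nbhs_normP[d1 /= d10 H1].
move/cvgrPdist_le : c2 => /(_ _ e2) /nbhs_normP[d2 /= d20 H2].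
have [|y1 [y2 [xy1 xy2 E]]] := meet (Num.min d1 d2);
  first by rewrite lt_min d10.
move: xy1 xy2; rewrite !lt_min => /andP[/H1 /= B1 _] /andP[_ /H2 /= B2].
rewrite [leRHS]splitr -(subrKA (F1 y1)) (le_trans (ler_normD _ _)) //.
by rewrite lerD ?B1 // E distrC B2.
Qed.

(** Both mixed derivatives, at suitable points close to x, are equal to the same
    second difference divided by h^2. *)
Lemma second_derivatives_commute (V : normedModType R) (f : V -> R) U x v w :
  open U -> Ck_on 2 U f -> U x ->
  'D_v (fun z => 'D_w f z) x = 'D_w (fun z => 'D_v f z) x.
Proof.
move=> oU fC Ux.
apply: (@eq_of_meeting_limits _ (fun y => 'D_v (fun z => 'D_w f z) y) (fun y =>
  'D_w (fun z => 'D_v f z) y)).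
- exact: Ck_on_continuous (Ck_on_derive v (Ck_on_derive w fC)) Ux.
- exact: Ck_on_continuous (Ck_on_derive w (Ck_on_derive v fC)) Ux.
move=> d0 d00.
have /nbhs_normP[d1 /= d10 Hd] := open_nbhs_nbhs (conj oU Ux).
pose d := Num.min d0 d1; have dp : 0 < d by rewrite lt_min d00.
have [h h0 hd] : exists2 h : R, 0 < h & h * (`|v| + `|w|) < d.
  have D0 : 0 < `|v| + `|w| + 1 by rewrite ltr_wpDl // addr_ge0.
  have h0 : 0 < d / (`|v| + `|w| + 1) by rewrite divr_gt0.
  exists (d / (`|v| + `|w| + 1)) => //.
  by rewrite -[ltRHS](divfK (lt0r_neq0 D0)) ltr_pM2l // ltrDl.
have inU v' w' s t : `|v'| + `|w'| = `|v| + `|w| -> 0 <= s <= 1 -> 0 <= t <=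
  1 ->
    `|x - (x + s *: (h *: v') + t *: (h *: w'))| < d.
  move=> E /andP[s0 s1] /andP[t0 t1].
  rewrite -addrA opprD addrA subrr sub0r normrN (le_lt_trans (ler_normD _ _))
    //.
  rewrite !normrZ (ger0_norm s0) (ger0_norm t0) [`|h|]gtr0_norm //.
  apply: (@le_lt_trans _ _ (h * (`|v'| + `|w'|))).
    by rewrite mulrDr lerD // -[leRHS]mul1r ler_wpM2r // mulr_ge0 // ltW.
  by rewrite E.
have small y : `|x - y| < d -> `|x - y| < d0 /\ U y.
  by rewrite lt_min => /andP[? ?]; split => //; exact: Hd.
have [|s [t [s01 t01 E1]]] := @second_difference _ f U x w v h h0 fC.
  by move=> s t s01 t01; have [] := small _ (inU w v s t (addrC _ _) s01 t01).
have [|s' [t' [s01' t01' E2]]] := @second_difference _ f U x v w h h0 fC.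
  by move=> s' t' s01' t01'; have [] := small _ (inU v w s' t' erefl s01' t01').
exists (x + s *: (h *: w) + t *: (h *: v)),
  (x + s' *: (h *: v) + t' *: (h *: w)).
split.
- by have [] := small _ (inU w v s t (addrC _ _) s01 t01).
- by have [] := small _ (inU v w s' t' erefl s01' t01').
have h20 : h ^+ 2 != 0 by rewrite expf_neq0 // gt_eqF.
apply: (mulfI h20); rewrite -E1 -E2 [x + h *: w + _]addrAC.
by move: (f _) (f _) (f _) (f _) => a b c d2; ring.
Qed.

Lemma derive2_comp m n (U : set 'rV[R]_m) (O : set 'rV[R]_n)
    (g : 'rV[R]_m -> 'rV[R]_n) (f : 'rV[R]_n -> R) x v w :
  open U -> open O -> (forall x, U x -> O (g x)) -> U x ->
  Ck_on 2 U g -> Ck_on 2 O f ->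
  'D_v (fun z => 'D_w (f \o g) z) x =
  'D_('D_v (fun z => 'D_w g z) x) f (g x) +
  \sum_i \sum_j ('D_v g x) 0 i * ('D_w g x) 0 j *
    'D_(basis_vec i) (fun z => 'D_(basis_vec j) f z) (g x).
Proof.
move=> oU oO gO Ux gC fC.
have dg z : U z -> differentiable g z by exact: Ck1_differentiable_mx gC.
have df z : O z -> differentiable f z by exact: Ck1_differentiable fC.
have Ogx := gO _ Ux.
have -> : 'D_v (fun z => 'D_w (f \o g) z) x =
   'D_v (\sum_(j < n) (fun z => ('D_w g z) 0 j * ('D_(basis_vec j) f \o g) z))
     x.
  apply: near_eq_derive; apply: (near_open oU Ux) => z Uz.
  have dfz := df _ (gO _ Uz).
  rewrite (derive_comp w (dg _ Uz) dfz) [LHS]derive_sum_basis //.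
  by rewrite fct_sumE.
have dgj j : derivable (fun z => ('D_w g z) 0 j) x v.
  exact: Ck_on_derivable (Ck_on_entry 0 j oU (Ck_on_derive w gC)) Ux.
have dfj j : differentiable ('D_(basis_vec j) f) (g x).
  exact: Ck1_differentiable (Ck_on_derive _ fC) Ogx.
have dfgj j : derivable ('D_(basis_vec j) f \o g) x v.
  apply: diff_derivable; apply: differentiable_comp => //; exact: dg.
rewrite derive_sum; last by move=> j; exact: derivableM.
rewrite [X in _ = X + _]derive_sum_basis; last exact: df.
rewrite exchange_big -big_split /=; apply: eq_bigr => j _.
have -> : 'D_v (fun z => ('D_w g z) 0 j * 'D_(basis_vec j) f (g z)) x =
    ('D_v (fun z => ('D_w g z) 0 j) x) * 'D_(basis_vec j) f (g x) +
    ('D_w g x) 0 j * 'D_v ('D_(basis_vec j) f \o g) x.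
  have -> := deriveM (dgj j) (dfgj j).
  by rewrite [RHS]addrC [X in _ = _ + X]mulrC.
congr (_ + _).
  rewrite [X in _ = X *: _](_ : _ = 'D_v (fun z => ('D_w g z) 0 j) x) //.
  by rewrite derive_mx ?mxE //; exact: Ck_on_derivable (Ck_on_derive w gC) Ux.
rewrite (derive_comp v (dg _ Ux) (dfj j)) [X in _ * X]derive_sum_basis //.
rewrite mulr_sumr; apply: eq_bigr => i _.
by rewrite -[X in _ * X]/(_ * _) mulrCA mulrA.
Qed.

End SecondDerivatives.

(** * Quadratic forms *)

Section Forms.
Context {R : realType}.

Definition pos n (B : 'M[R]_n) : Prop :=
  forall v : 'rV[R]_n, v != 0 -> 0 < bil B v v.

Lemma bilDl n (B : 'M[R]_n) u v w : bil B (u + v) w = bil B u w + bil B v w.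
Proof. by rewrite /bil !mulmxDl mxE. Qed.

Lemma bilDr n (B : 'M[R]_n) u v w : bil B w (u + v) = bil B w u + bil B w v.
Proof. by rewrite /bil linearD /= mulmxDr mxE. Qed.

Lemma bilZl n (B : 'M[R]_n) a v w : bil B (a *: v) w = a * bil B v w.
Proof. by rewrite /bil -!scalemxAl mxE. Qed.

Lemma bilZr n (B : 'M[R]_n) a v w : bil B v (a *: w) = a * bil B v w.
Proof. by rewrite /bil linearZ /= -scalemxAr mxE. Qed.

Lemma bil0l n (B : 'M[R]_n) w : bil B 0 w = 0.
Proof. by rewrite /bil !mul0mx mxE. Qed.

Lemma bil_sym n (B : 'M[R]_n) v w : B^T = B -> bil B v w = bil B w v.
Proof.
move=> sB; rewrite /bil -[in LHS](trmxK (v *m B *m w^T)) [LHS]mxE.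
by rewrite !trmx_mul trmxK sB mulmxA.
Qed.

Lemma bil_mxD n (A B : 'M[R]_n) v w : bil (A + B) v w = bil A v w + bil B v w.
Proof. by rewrite /bil mulmxDr mulmxDl mxE. Qed.

Lemma bil_mxN n (A : 'M[R]_n) v w : bil (- A) v w = - bil A v w.
Proof. by rewrite /bil mulmxN mulNmx mxE. Qed.

Lemma bil_mxZ n a (A : 'M[R]_n) v w : bil (a *: A) v w = a * bil A v w.
Proof. by rewrite /bil -scalemxAr -scalemxAl mxE. Qed.

Lemma bil_congr m n (D : 'M[R]_(m, n)) (B : 'M[R]_n) v w :
  bil (D *m B *m D^T) v w = bil B (v *m D) (w *m D).
Proof. by rewrite /bil trmx_mul !mulmxA. Qed.

Lemma bil_gram n k (Z : 'M[R]_(k, n)) v :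
  bil (Z^T *m Z) v v = \sum_i (v *m Z^T) 0 i ^+ 2.
Proof.
rewrite /bil mulmxA -mulmxA -[Z *m v^T]trmxK trmx_mul trmxK mxE.
by apply: eq_bigr => i _; rewrite [in X in _ * X]mxE expr2.
Qed.

Lemma bil_outer n (z : 'rV[R]_n) v : bil (z^T *m z) v v = (v *m z^T) 0 0 ^+ 2.
Proof. by rewrite bil_gram big_ord1. Qed.

Lemma bil_sum n (B : 'M[R]_n) v w :
  bil B v w = \sum_i \sum_j v 0 i * B i j * w 0 j.
Proof.
rewrite /bil mxE exchange_big; apply: eq_bigr => j _.
by rewrite !mxE mulr_suml.
Qed.

Lemma bil_rows n k (V : 'M[R]_(k, n)) (B : 'M[R]_n) i j :
  bil B (row i V) (row j V) = (V *m B *m V^T) i j.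
Proof.
rewrite /bil -row_mul [LHS]mxE [RHS]mxE; apply: eq_bigr => l _.
by congr (_ * _); rewrite [LHS]mxE // mxE [RHS]mxE.
Qed.

Lemma posdef_ge0 n (g : 'M[R]_n) v : posdef g -> 0 <= bil g v v.
Proof.
move=> [_ gp]; have [->|/gp/ltW//] := eqVneq v 0; by rewrite bil0l.
Qed.

Lemma posdef_unit n (g : 'M[R]_n) : posdef g -> g \in unitmx.
Proof.
move=> [_ gp]; rewrite -row_free_unit -kermx_eq0; apply/eqP/row_matrixP => i.
rewrite row0; apply/eqP; apply: contraTT isT => /gp.
have /row_matrixP/(_ i) := mulmx_ker g.
by rewrite row_mul row0 /bil => ->; rewrite mul0mx mxE ltxx.
Qed.

Lemma posdef_invmx n (g : 'M[R]_n) : posdef g -> (invmx g)^T = invmx g.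
Proof. by move=> [gs _]; rewrite trmx_inv gs. Qed.

Lemma bil_invmx n (g : 'M[R]_n) p : posdef g ->
  bil (invmx g) p p = bil g (p *m invmx g) (p *m invmx g).
Proof.
move=> gp; rewrite /bil trmx_mul (posdef_invmx gp).
by rewrite !mulmxA mulmxKV // posdef_unit.
Qed.

Lemma bil_invmx_ge0 n (g : 'M[R]_n) p : posdef g -> 0 <= bil (invmx g) p p.
Proof. by move=> gp; rewrite bil_invmx //; exact: posdef_ge0. Qed.

Lemma bil_cauchy_schwarz n (g : 'M[R]_n) v w : posdef g ->
  bil g v w ^+ 2 <= bil g v v * bil g w w.
Proof.
move=> gp; have [->|w0] := eqVneq w 0.
  by rewrite (bil_sym _ _ gp.1) !bil0l expr0n mulr0.
have gw := gp.2 _ w0.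
have := posdef_ge0 (bil g w w *: v + (- bil g v w) *: w) gp.
rewrite !(bilDl, bilDr, bilZl, bilZr) (bil_sym w v gp.1).
move: gw; move: (bil g w w) (bil g v v) (bil g v w) => c a b c0 H.
rewrite -subr_ge0 -(pmulr_rge0 _ c0).
by apply: le_trans H _; rewrite le_eqVlt; apply/orP; left; apply/eqP; ring.
Qed.

(** The Cauchy-Schwarz inequality for a covector p and a vector w: p is the
    g-product with the vector p g^-1, whose square norm is that of p. *)
Lemma pairing_cauchy_schwarz n (g : 'M[R]_n) (p w : 'rV[R]_n) : posdef g ->
  (w *m p^T) 0 0 ^+ 2 <= bil (invmx g) p p * bil g w w.
Proof.
move=> gp; rewrite bil_invmx // mulrC.
apply: le_trans (bil_cauchy_schwarz w _ gp); rewrite le_eqVlt; apply/orP; left.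
apply/eqP; congr (_ ^+ 2); rewrite /bil trmx_mul (posdef_invmx gp).
by rewrite -!mulmxA mulKVmx // posdef_unit.
Qed.

(** The values of M at s v + w are affine in s when M vanishes at v; they are
    nonnegative for all s, so the slope 2 M(v, w) is zero. *)
Lemma psd_null n (M : 'M[R]_n) v : M^T = M -> (forall w, 0 <= bil M w w) ->
  bil M v v = 0 -> v *m M = 0.
Proof.
move=> sM Mp Mv; apply/rowP => i; rewrite [RHS]mxE.
suff : bil M v (basis_vec i) = 0.
  by rewrite /bil /basis_vec trmx_delta -colE mxE.
apply/eqP; apply: contraT => b0.
set w := basis_vec i in b0 *.
(* The value of s at which the affine function of s equals -1. *)
have := Mp ((- (bil M w w + 1) / (2 * bil M v w)) *: v + w).
rewrite !(bilDl, bilDr, bilZl, bilZr) (bil_sym w v sM) Mv.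
move: b0; move: (bil M v w) (bil M w w) => b c b0.
have -> : (- (c + 1) / (2 * b)) * ((- (c + 1) / (2 * b)) * 0)
  + (- (c + 1) / (2 * b)) * b +
  ((- (c + 1) / (2 * b)) * b + c) = - 1 by field.
by rewrite ler0N1.
Qed.

End Forms.

(** * Simultaneous diagonalization of two quadratic forms *)

Section Sphere.
Context {R : realType}.

Lemma sphere_compact n : compact [set v : 'rV[R]_n | `|v| = 1].
Proof.
apply: bounded_closed_compact.
  by exists 1; split=> [|M M1 v /= ->]; [exact: num_real|exact: ltW].
have -> : [set v : 'rV[R]_n | `|v| = 1] = (fun v => `|v|) @^-1` [set x |
  x = 1] by [].
apply: closed_comp; last exact: closed_eq.
by move=> v _; exact: norm_continuous.
Qed.

Lemma bil_continuous_at (T : topologicalType) n (P : T -> 'M[R]_n)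
    (v w : T -> 'rV[R]_n) c :
  (forall i j, {for c, continuous (fun x => P x i j)}) ->
  (forall i, {for c, continuous (fun x => v x 0 i)}) ->
  (forall i, {for c, continuous (fun x => w x 0 i)}) ->
  {for c, continuous (fun x => bil (P x) (v x) (w x))}.
Proof.
move=> Pc vc wc.
rewrite (_ : (fun _ => _) = fun x => \sum_i \sum_j v x 0 i * P x i j * w x 0 j).
  apply: continuous_at_sum => i; apply: continuous_at_sum => j.
  by apply: continuous_atM => //; exact: continuous_atM.
by apply/funext => x; exact: bil_sum.
Qed.

(** Positivity on the unit sphere, which is compact, persists under small
    perturbations uniformly in the vector. *)
Lemma pos_near (T : topologicalType) n (P : T -> 'M[R]_n) c :
  (forall i j, {for c, continuous (fun x => P x i j)}) -> pos (P c) ->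
  \forall x \near c, pos (P x).
Proof.
move=> Pc pc.
have /compact_near_coveringP := @sphere_compact n.
move=> /(_ T (nbhs c) (fun x v => is_true (0 < bil (P x) v v)) (nbhs_filter c))
  H.
have {H} : \forall x \near c, [set v : 'rV[R]_n | `|v| = 1] `<=` (fun v =>
  is_true (0 < bil (P x) v v)).
  apply: H => v /= v1.
  have v0 : v != 0 by rewrite -normr_eq0 v1 oner_eq0.
  have : {for (v, c), continuous (fun z : 'rV[R]_n * T => bil (P z.2) z.1 z.1)}.
    have fc i : {for (v, c), continuous (fun z : 'rV[R]_n * T => z.1 0 i : R)}.
      apply: (@continuous_comp _ _ _ fst (fun v : 'rV[R]_n => v 0 i)).
        exact: cvg_fst.
      exact: coord_continuous.
    apply: bil_continuous_at => // i j.
    by apply: (@continuous_comp _ _ _ snd (fun x => P x i j));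
      [exact: cvg_snd|exact: Pc].
  move=> /(_ _ (open_nbhs_nbhs (conj (@open_gt R 0) (pc _ v0)))) N.
  exact: N.
apply: filterS => x Hx v v0.
have nv0 : 0 < `|v| by rewrite normr_gt0.
have := Hx (`|v|^-1 *: v); rewrite bilZl bilZr !pmulr_rgt0 ?invr_gt0 //;
  apply => /=.
by rewrite normrZ normfV normr_id mulVf // gt_eqF.
Qed.

(** A minimum point of the Rayleigh quotient on the unit sphere: A - l g is
    positive semidefinite and vanishes at v, hence kills v. *)
Lemma min_eigenvector n (g A : 'M[R]_n.+1) : posdef g -> A^T = A ->
  exists l v, [/\ bil g v v = 1, v *m A = l *: (v *m g) &
    forall w, l * bil g w w <= bil A w w].
Proof.
move=> gp sA.
pose h v := bil A v v / bil g v v.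
have hZ a v : a != 0 -> h (a *: v) = h v.
  by move=> a0; rewrite /h !(bilZl, bilZr) !mulrA -mulf_div divff ?mulf_neq0 //
    mul1r.
have [||c] := @EVT_min_rV R n.+1 h _ _ (@sphere_compact n.+1).
- have e0 : (basis_vec ord0 : 'rV[R]_n.+1) != 0.
    by apply/eqP => /rowP/(_ ord0)/eqP; rewrite !mxE eqxx oner_eq0.
  exists (`|basis_vec ord0 : 'rV[R]_n.+1|^-1 *: basis_vec ord0) => /=.
  by rewrite normrZ normfV normr_id mulVf // normr_eq0.
- apply: continuous_in_subspaceT => v; rewrite inE /= => v1.
  have v0 : v != 0 by rewrite -normr_eq0 v1 oner_eq0.
  have bc B : {for v, continuous (fun v : 'rV[R]_n.+1 => bil B v v)}.
    apply: bil_continuous_at => [i j|i|i]; first exact: continuous_at_cst.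
      exact: coord_continuous.
    exact: coord_continuous.
  apply: (@continuous_atM _ 'rV[R]_n.+1 (fun v => bil A v v) (fun v =>
    (bil g v v)^-1)).
    exact: bc.
  by apply: continuousV; [rewrite gt_eqF // gp.2|exact: bc].
rewrite inE /= => c1 minc.
have c0 : c != 0 by rewrite -normr_eq0 c1 oner_eq0.
have gc := gp.2 _ c0.
have min w : h c * bil g w w <= bil A w w.
  have [->|w0] := eqVneq w 0; first by rewrite !bil0l mulr0.
  have nw0 : 0 < `|w| by rewrite normr_gt0.
  have := minc (`|w|^-1 *: w);
    rewrite inE /= normrZ normfV normr_id mulVf ?gt_eqF // => /(_ erefl).
  by rewrite hZ ?invr_eq0 ?gt_eqF // {2}/h ler_pdivlMr // gp.2.
have cN : c *m (A - h c *: g) = 0.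
  apply: psd_null => [|w|].
  - by rewrite linearB linearZ /= sA gp.1.
  - by rewrite bil_mxD bil_mxN bil_mxZ subr_ge0.
  - by rewrite bil_mxD bil_mxN bil_mxZ /h divfK ?subrr // gt_eqF.
exists (h c), ((Num.sqrt (bil g c c))^-1 *: c); split => //.
  rewrite bilZl bilZr mulrA -invfM -expr2 sqr_sqrtr ?ltW //.
  by rewrite mulVf // gt_eqF.
move: cN; rewrite mulmxBr -scalemxAr => /eqP; rewrite subr_eq0 => /eqP E.
by rewrite -!scalemxAl E !scalerA mulrC.
Qed.

(** Induction on the dimension: split off the eigenvector of the lowest
    eigenvalue and pass to its g-orthogonal complement. Starting with the
    lowest one makes the diagonal nondecreasing. *)
Lemma simultaneous_diagonalization n (g A : 'M[R]_n) : posdef g -> A^T = A ->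
  exists (V : 'M[R]_n) (l : 'rV[R]_n), [/\ V *m g *m V^T = 1%:M,
    V *m A *m V^T = diag_mx l & forall i j : 'I_n, (i <= j)%N -> l 0 i <=
      l 0 j].
Proof.
elim: n g A => [|n IHn] g A gp sA.
  by exists 0, 0; split => [||[]//]; apply/matrixP => -[].
have [l0 [v [gv Av minl]]] := min_eigenvector gp sA.
have gvE : v *m g *m v^T = 1%:M by rewrite [LHS]mx11_scalar -/(bil g v v) gv.
(* The rows of K form a basis of the g-orthogonal complement of v. *)
have [K Kf Kgv] : exists2 K : 'M[R]_(n, n.+1), row_free K & K *m (g *m v^T) = 0.
  have rk : \rank (kermx (g *m v^T)) = n.
    have gv0 : (g *m v^T)^T != 0.
      apply/eqP => E; have := gvE;
        rewrite -mulmxA -[g *m v^T]trmxK E trmx0 mulmx0.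
      by move/matrixP/(_ 0 0)/eqP; rewrite !mxE eqxx eq_sym oner_eq0.
    by rewrite mxrank_ker -mxrank_tr rank_rV gv0 subn1.
  have K0 : row_base (kermx (g *m v^T)) *m (g *m v^T) = 0.
    by apply/sub_kermxP; rewrite eq_row_base.
  have := row_base_free (kermx (g *m v^T)).
  by move: (row_base _) K0; rewrite rk => K K0 Kf; exists K.
have gK : posdef (K *m g *m K^T).
  split; first by rewrite !trmx_mul trmxK gp.1 mulmxA.
  by move=> w w0; rewrite bil_congr gp.2 // mulmx_free_eq0.
have sAK : (K *m A *m K^T)^T = K *m A *m K^T.
  by rewrite !trmx_mul trmxK sA mulmxA.
have [V [l [Vg VA sl]]] := IHn _ _ gK sAK.
have vgK : v *m g *m K^T = 0.
  by apply: trmx_inj; rewrite !trmx_mul trmxK gp.1 Kgv trmx0.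
have KAv : K *m A *m v^T = 0.
  apply: trmx_inj; rewrite !trmx_mul trmxK sA mulmxA Av -scalemxAl vgK.
  by rewrite scaler0 trmx0.
have vAK : v *m A *m K^T = 0 by rewrite Av -scalemxAl vgK scaler0.
have lj j : l0 <= l 0 j.
  have := minl (row j V *m K); rewrite -!bil_congr.
  rewrite !bil_rows.
  by rewrite Vg VA !mxE eqxx mulr1 mulr1n.
have blocks B : K *m B *m v^T = 0 -> v *m B *m K^T = 0 ->
    col_mx v (V *m K) *m B *m (col_mx v (V *m K))^T =
    block_mx (v *m B *m v^T) 0 0 (V *m (K *m B *m K^T) *m V^T).
  move=> KBv vBK; rewrite tr_col_mx mul_col_mx mul_col_row trmx_mul;
    congr block_mx.
  - by rewrite mulmxA vBK mul0mx.
  - by rewrite -(mulmxA V K) -(mulmxA V) KBv mulmx0.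
  - by rewrite !mulmxA.
exists (col_mx v (V *m K)), (row_mx l0%:M l); split.
- by rewrite blocks // ?gvE ?Vg -?scalar_mx_block // -mulmxA.
- rewrite blocks // VA.
  transitivity (block_mx (diag_mx (l0%:M : 'rV[R]_1)) 0 0 (diag_mx l));
    last first.
    by rewrite -diag_mx_row.
  suff -> : v *m A *m v^T = diag_mx (l0%:M : 'rV[R]_1) by [].
  rewrite [LHS]mx11_scalar [RHS]mx11_scalar; congr _%:M.
  by rewrite /bil Av -scalemxAl mxE -/(bil g v v) gv mulr1 !mxE eqxx !mulr1n.
- move=> i j ij; rewrite !mxE.
  case: (@splitP 1 n i) => i' Ei; case: (@splitP 1 n j) => j' Ej.
  + by rewrite !ord1.
  + by rewrite ord1 mxE eqxx mulr1n.
  + by move: ij; rewrite Ei Ej ord1.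
  + by apply: sl; move: ij; rewrite Ei Ej leq_add2l.
Qed.

End Sphere.

(** * Certificates for lower bounds on eigenvalues *)

Section Eigenvalues.
Context {R : realType}.

Lemma char_poly_conj n (P A B : 'M[R]_n) :
  P \in unitmx -> P *m A = B *m P -> char_poly A = char_poly B.
Proof.
move=> uP PA.
have E : map_mx polyC P *m char_poly_mx A = char_poly_mx B *m map_mx polyC P.
  rewrite /char_poly_mx mulmxBr mulmxBl -!map_mxM PA.
  by rewrite mul_mx_scalar mul_scalar_mx.
have := congr1 determinant E; rewrite !det_mulmx mulrC.
apply: mulIf; rewrite det_map_mx polyC_eq0.
by rewrite -unitfE -unitmxE.
Qed.

(** A g^-1 is conjugate to the diagonal matrix of the l_i, and a sorted list is
    determined by the monic polynomial of which it lists the roots. *)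
Lemma eigenvalues_spectral n (g A V : 'M[R]_n) (l : 'rV[R]_n) : posdef g ->
  V *m g *m V^T = 1%:M -> V *m A *m V^T = diag_mx l ->
  (forall i j : 'I_n, (i <= j)%N -> l 0 i <= l 0 j) ->
  eigenvalues g A = [seq l 0 i | i <- enum 'I_n].
Proof.
move=> gp Vg VA sl.
have [uV _] := mulmx1_unit (etrans (mulmxA V g V^T) Vg).
have gI : invmx g = V^T *m V.
  have := mulmx1C (etrans (mulmxA V g V^T) Vg); rewrite -mulmxA => E.
  by rewrite -[LHS]mulmx1 -E mulKmx // posdef_unit.
have cp : char_poly (A *m invmx g) = \prod_(t <- [seq l 0 i | i <- enum 'I_n])
  ('X - t%:P).
  rewrite (@char_poly_conj _ V _ (diag_mx l)) //;
    last by rewrite gI -VA !mulmxA.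
  rewrite char_poly_trig ?diag_mx_is_trig // big_map big_enum /=.
  by apply: eq_bigr => i _; rewrite mxE eqxx mulr1n.
have ss : sorted <=%R [seq l 0 i | i <- enum 'I_n].
  rewrite sorted_map; apply: (@sub_sorted _ (relpre val leq)) => [i j /=|];
    first exact: sl.
  by rewrite -sorted_map val_enum_ord iota_sorted.
rewrite /eigenvalues; set P := (X in xget _ X).
have [s1 s2] : P (xget [::] P) by apply: (@xgetPex _ [::] P);
  exists [seq l 0 i | i <- enum 'I_n].
apply: (@sorted_eq _ <=%R) => //.
- exact: le_trans.
- exact: le_anti.
- by apply: prod_XsubC_eq; rewrite -s2 -cp.
Qed.

Lemma eigenvalues_nth n (l : 'rV[R]_n) (i : 'I_n) :
  [seq l 0 j | j <- enum 'I_n]`_i = l 0 i.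
Proof. by rewrite (nth_map i) ?size_enum_ord // nth_ord_enum. Qed.

End Eigenvalues.

Section Certificates.
Context {R : realType}.

(** With k + 1 eigenvalues involved, the lower bound certified by s and c, see
    spectral_cert. *)
Definition spectral_cert_value (b : spectral_kind) k (s : R)
  (c : 'I_k -> R) : R :=
  match b with
  | KthEigenvalue => s
  | SumOfFirstK => k.+1%:R * s - \sum_i c i
  end.

(** The two spectral functions are the minima, over g-orthonormal frames V of
    k + 1 vectors, of the largest eigenvalue and of the trace of V A V^T. Here
    (s, Z, c) is a dual certificate for these minima: s g is a lower bound for
    A up to the form Z^T Z of rank at most k, and c_i bounds the square
    g-norm of the i-th row of Z, seen as a covector. Strict inequalities
    everywhere make this an open condition on (g, A), without inverting g. *)
Definition spectral_cert (b : spectral_kind) k n (g A : 'M[R]_n)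
  (t : R) : Prop :=
  exists (s : R) (Z : 'M[R]_(k, n)) (c : 'I_k -> R),
    [/\ pos (A + Z^T *m Z - s *: g),
        forall i, pos (c i *: g - (row i Z)^T *m row i Z) &
        t < spectral_cert_value b s c].

Lemma kernel_vector k (M : 'M[R]_(k.+1, k)) :
  exists2 z : 'rV[R]_k.+1, z != 0 & z *m M = 0.
Proof.
have : kermx M != 0.
  rewrite kermx_eq0; apply/negP => /eqP E.
  by have := rank_leq_col M; rewrite E ltnn.
move=> /rowV0Pn[z /sub_kermxP zM z0]; by exists z.
Qed.

(** Let W be the span of the first k + 1 eigenvectors. For the eigenvalue, some
    nonzero vector of W is killed by Z, and there s g < A <= l_k g. For
    the sum, add up s g < A + Z^T Z over the eigenvectors that span W; by the
    Bessel inequality each row of Z contributes at most c_i. *)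
Lemma spectral_cert_sound b k n (g A : 'M[R]_n) t : posdef g -> A^T = A ->
  (k < n)%N ->
  spectral_cert b k g A t -> t < spectral_fun b k.+1 (eigenvalues g A).
Proof.
move=> gp sA kn [s [Z [c [pA pc tc]]]].
have [V [l [Vg VA sl]]] := simultaneous_diagonalization gp sA.
rewrite (eigenvalues_spectral gp Vg VA sl).
pose W := rowsub (widen_ord kn) V.
have Wg : W *m g *m W^T = 1%:M.
  apply/matrixP => i j; rewrite -bil_rows !row_rowsub bil_rows Vg !mxE.
  by congr (_ %:R).
have WA i j : bil A (row i W) (row j W) = l 0 (widen_ord kn i) *+ (i == j).
  by rewrite !row_rowsub bil_rows VA mxE.
have WAm : W *m A *m W^T = diag_mx (colsub (widen_ord kn) l).
  by apply/matrixP => i j; rewrite -bil_rows WA !mxE.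
have bg z : bil g (z *m W) (z *m W) = \sum_i z 0 i ^+ 2.
  rewrite -bil_congr Wg /bil mulmx1 mxE; apply: eq_bigr => i _.
  by rewrite mxE expr2.
have bA z : bil A (z *m W) (z *m W) = \sum_i l 0 (widen_ord kn i) * z 0 i ^+ 2.
  rewrite -bil_congr WAm /bil mul_mx_diag mxE; apply: eq_bigr => i _.
  by rewrite !mxE expr2 mulrA mulrAC mulrC mulrA.
have z2 (z : 'rV[R]_k.+1) : z != 0 -> 0 < \sum_i z 0 i ^+ 2.
  move=> z0; rewrite lt0r sumr_ge0 ?andbT; last by move=> i _; exact: sqr_ge0.
  apply: contra z0; rewrite psumr_eq0; last by move=> i _; exact: sqr_ge0.
  move=> /allP E; apply/eqP/rowP => i; rewrite mxE; apply/eqP.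
  by have := E i (mem_index_enum _); rewrite sqrf_eq0.
have nz (z : 'rV[R]_k.+1) : z != 0 -> z *m W != 0.
  move=> z0; apply/eqP => E; have := z2 _ z0.
  by rewrite -bg E bil0l ltxx.
case: b tc => /= tc.
  have [z z0 zZ] := kernel_vector (W *m Z^T).
  have := pA _ (nz z z0); rewrite bil_mxD bil_mxN bil_mxZ bil_mxD bil_gram.
  rewrite -mulmxA zZ big1 ?addr0; last by move=> i _; rewrite mxE expr0n.
  rewrite bg bA subr_gt0 => H; apply: lt_le_trans tc _.
  rewrite (_ : _`_k = l 0 (widen_ord kn ord_max)); last first.
    exact: (eigenvalues_nth l (widen_ord kn ord_max)).
  rewrite -(ler_pM2r (z2 _ z0)); apply: le_trans (ltW H) _.
  rewrite mulr_sumr; apply: ler_sum => i _; rewrite ler_wpM2r ?sqr_ge0 //.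
  by apply: sl => /=; rewrite -ltnS.
apply: lt_le_trans tc _.
rewrite (eq_bigr (fun i : 'I_k.+1 => l 0 (widen_ord kn i))); last first.
  by move=> i _; rewrite -[RHS]eigenvalues_nth.
pose q i j := (row i W *m Z^T) 0 j.
have H1 i : s <= l 0 (widen_ord kn i) + \sum_j q i j ^+ 2.
  have ri : row i W = delta_mx 0 i *m W by rewrite rowE.
  have := pA (row i W); rewrite {1}ri nz; last first.
    by apply/eqP => /rowP/(_ i)/eqP; rewrite !mxE !eqxx oner_eq0.
  move=> /(_ isT); rewrite bil_mxD bil_mxN bil_mxZ bil_mxD bil_gram WA eqxx
    mulr1n.
  by rewrite bil_rows Wg mxE eqxx mulr1 subr_gt0 => /ltW.
have H2 j : \sum_i q i j ^+ 2 <= c j.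
  pose z : 'rV[R]_k.+1 := \row_i q i j.
  have qz : \sum_i q i j ^+ 2 = \sum_i z 0 i ^+ 2.
    by apply: eq_bigr => i _; rewrite mxE.
  have zq : (z *m W *m (row j Z)^T) 0 0 = \sum_i q i j ^+ 2.
    rewrite -mulmxA mxE; apply: eq_bigr => i _; rewrite mxE expr2;
      congr (_ * _).
    by rewrite /q !mxE; apply: eq_bigr => a _; rewrite !mxE.
  have [z0|z0] := eqVneq z 0.
    rewrite qz z0 big1; last by move=> i _; rewrite mxE expr0n.
    have d0 : (delta_mx 0 0 : 'rV[R]_k.+1) != 0.
      by apply/eqP => /rowP/(_ 0)/eqP; rewrite !mxE !eqxx oner_eq0.
    have := pc j _ (nz _ d0);
      rewrite bil_mxD bil_mxN bil_mxZ bil_outer subr_gt0.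
    move=> /(le_lt_trans (sqr_ge0 _)); rewrite pmulr_lgt0; first exact: ltW.
    by rewrite bg z2.
  have := pc j _ (nz _ z0);
    rewrite bil_mxD bil_mxN bil_mxZ bil_outer subr_gt0 zq bg -qz.
  rewrite expr2 ltr_pM2r; first exact: ltW.
  by rewrite qz z2.
rewrite lerBlDr.
have -> : k.+1%:R * s = \sum_(i < k.+1) s by rewrite sumr_const card_ord
  mulr_natl.
apply: (@le_trans _ _
  (\sum_(i < k.+1) (l 0 (widen_ord kn i) + \sum_j q i j ^+ 2))).
  exact: ler_sum.
rewrite big_split /= lerD2l exchange_big /=; exact: ler_sum.
Qed.

End Certificates.

Section SpectralFun.
Context {R : realType}.

(** In an eigenbasis, choose Z such that Z^T Z raises the k lowest eigenvalues
    l_i to the next one, L: its rows have square norms L - l_i. Then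
    A + Z^T Z >= L g, and a small d > 0 buys the strict inequalities. *)
Lemma spectral_cert_complete b k n (g A : 'M[R]_n) t : posdef g -> A^T = A ->
  (k < n)%N ->
  t < spectral_fun b k.+1 (eigenvalues g A) -> spectral_cert b k g A t.
Proof.
move=> gp sA kn.
have [V [l [Vg VA sl]]] := simultaneous_diagonalization gp sA.
rewrite (eigenvalues_spectral gp Vg VA sl).
have gVV : g *m V^T *m V = 1%:M by apply: mulmx1C; rewrite mulmxA.
(* The eigenvalue to which the k lower ones are raised. *)
pose L := l 0 (Ordinal kn).
pose wk (i : 'I_k) : 'I_n := widen_ord (ltnW kn) i.
have wkL i : l 0 (wk i) <= L by apply: sl => /=; exact/ltnW.
pose Z : 'M[R]_(k, n) :=
  \matrix_i (Num.sqrt (L - l 0 (wk i)) *: (row (wk i) V *m g)).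
have frame v : exists z : 'rV[R]_n, [/\ bil g v v = \sum_i z 0 i ^+ 2,
    bil A v v = \sum_i l 0 i * z 0 i ^+ 2 &
    forall i, (v *m (row i Z)^T) 0 0 ^+ 2 = (L - l 0 (wk i)) * z 0 (wk i) ^+ 2].
  have [z ->] : exists z, v = z *m V.
    by exists (v *m g *m V^T); rewrite -!mulmxA (mulmxA g) gVV mulmx1.
  exists z; split.
  - rewrite -bil_congr Vg /bil mulmx1 mxE; apply: eq_bigr => i _.
    by rewrite mxE expr2.
  - rewrite -bil_congr VA /bil mul_mx_diag mxE; apply: eq_bigr => i _.
    by rewrite !mxE expr2 mulrA [z 0 i * _]mulrC.
  - move=> i; rewrite rowK linearZ /= -scalemxAr mxE exprMn sqr_sqrtr
      ?subr_ge0 //.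
    congr (_ * _ ^+ 2).
    rewrite rowE !trmx_mul gp.1 trmx_delta !mulmxA -(mulmxA z) -(mulmxA z) Vg
      mulmx1.
    by rewrite -colE mxE.
(* The strict inequalities cost at most (2 k + 1) d in the certified value. *)
have [d d0 dt] : exists2 d, 0 < d &
    t < spectral_fun b k.+1 [seq l 0 i | i <- enum 'I_n] ->
    t < spectral_cert_value b (L - d) (fun i : 'I_k => L - l 0 (wk i) + d).
  pose S := spectral_fun b k.+1 [seq l 0 i | i <- enum 'I_n].
  have k1 : 1 <= k.+1%:R :> R by rewrite ler1n.
  have [tS|St] := ltP t S; last first.
    by exists 1 => //; rewrite -/S ltNge St.
  have D0 : 0 < 2 * k.+1%:R :> R by rewrite mulr_gt0.
  exists ((S - t) / (2 * k.+1%:R)); first by rewrite divr_gt0 // subr_gt0.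
  have nthE (i : 'I_n) := eigenvalues_nth l i.
  have nthL : [seq l 0 i | i <- enum 'I_n]`_k = L by exact: nthE (Ordinal kn).
  move=> _; case: b @S tS => /= tS.
    rewrite nthL in tS *; rewrite ltrBrDr addrC -ltrBrDr ltr_pdivrMr //.
    rewrite -[ltLHS]mulr1 ltr_pM2l ?subr_gt0 //; lra.
  have SE : \sum_(i < k.+1) [seq l 0 i | i <- enum 'I_n]`_i =
    L + \sum_i l 0 (wk i).
    rewrite big_ord_recr [RHS]addrC /=; congr (_ + _); last exact: nthL.
    by apply: eq_bigr => i _; exact: nthE (wk i).
  have sumE d : \sum_i (L - l 0 (wk i) + d) =
      (k.+1%:R - 1) * L - \sum_i l 0 (wk i) + (k.+1%:R - 1) * d.
    by rewrite big_split sumrB !sumr_const card_ord /= -natr1 addrK !mulr_natl.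
  rewrite SE in tS *; rewrite sumE.
  have [d dE d0] : exists2 d,
    d = (L + \sum_i l 0 (wk i) - t) / (2 * k.+1%:R) & 0 < d.
    by eexists; [reflexivity | rewrite divr_gt0 // subr_gt0].
  have dE' : (2 * k.+1%:R) * d = L + \sum_i l 0 (wk i) - t.
    by rewrite dE mulrC divfK // gt_eqF.
  rewrite -dE; lra.
move=> /dt {}dt; exists (L - d), Z, (fun i => L - l 0 (wk i) + d); split => //.
- move=> v v0; have [z [gz Az Zz]] := frame v.
  rewrite bil_mxD bil_mxN bil_mxZ bil_mxD bil_gram.
  rewrite (eq_bigr (fun i => (L - l 0 (wk i)) * z 0 (wk i) ^+ 2)); last first.
    by move=> i _; rewrite -Zz; congr (_ ^+ 2); rewrite !mxE; apply: eq_bigr =>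
      a _; rewrite !mxE.
  have := gp.2 _ v0; rewrite Az gz => z2.
  have -> : \sum_(i < k) (L - l 0 (wk i)) * z 0 (wk i) ^+ 2 =
     \sum_(i < n) (if (i < k)%N then (L - l 0 i) * z 0 i ^+ 2 else 0).
    by rewrite -big_mkcond (big_ord_narrow (ltnW kn)).
  rewrite mulr_sumr -big_split -sumrB /=.
  apply: (@lt_le_trans _ _ (\sum_(i < n) d * z 0 i ^+ 2)).
    by rewrite -mulr_sumr mulr_gt0.
  apply: ler_sum => i _; case: ltnP => ik.
    by rewrite -mulrDl -mulrBl ler_wpM2r ?sqr_ge0 //; lra.
  have Ll : L <= l 0 i by apply: sl.
  by rewrite addr0 -mulrBl ler_wpM2r ?sqr_ge0 //; lra.
- move=> i v v0; have [z [gz Az Zz]] := frame v.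
  rewrite bil_mxD bil_mxN bil_mxZ bil_outer Zz.
  have := gp.2 _ v0; rewrite gz => z2.
  rewrite subr_gt0 [ltRHS]mulrDl ltr_pwDr ?mulr_gt0 // ler_wpM2l ?subr_ge0 //.
  by rewrite (bigD1 (wk i)) //= lerDl sumr_ge0 // => j _; exact: sqr_ge0.
Qed.

Lemma spectral_cert_congr b k m n (D : 'M[R]_(m, n)) (g A : 'M[R]_n) t :
  row_free D -> spectral_cert b k g A t -> spectral_cert b k (D *m g *m D^T)
    (D *m A *m D^T) t.
Proof.
move=> Df [s [Z [c [pA pc tc]]]]; exists s, (Z *m D^T), c; split => //.
- move=> v v0; have := pA (v *m D); rewrite mulmx_free_eq0 // => /(_ v0).
  by rewrite !(bil_mxD, bil_mxN, bil_mxZ) !bil_congr !bil_gram trmx_mul trmxK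
    !mulmxA.
- move=> i v v0; have := pc i (v *m D); rewrite mulmx_free_eq0 // => /(_ v0).
  rewrite !(bil_mxD, bil_mxN, bil_mxZ) !bil_congr !bil_outer row_mul.
  by rewrite trmx_mul trmxK !mulmxA.
Qed.

Lemma spectral_cert_shift b k n (g A A' : 'M[R]_n) t e : 0 <= e -> posdef g ->
  (forall v, bil A v v <= bil A' v v + e * bil g v v) ->
  spectral_cert b k g A t -> spectral_cert b k g A' (t - k.+1%:R * e).
Proof.
move=> e0 gp AA' [s [Z [c [pA pc tc]]]]; exists (s - e), Z, c; split => //.
- move=> v v0; apply: lt_le_trans (pA _ v0) _.
  by rewrite !(bil_mxD, bil_mxN, bil_mxZ); have := AA' v; lra.
- case: b tc => /= tc; last by rewrite mulrBr; lra.
  suff : e <= k.+1%:R * e by lra.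
  by rewrite ler_peMl // ler1n.
Qed.

Lemma spectral_cert_zero b k n (g : 'M[R]_n) t : posdef g -> t < 0 ->
  spectral_cert b k g 0 t.
Proof.
move=> gp t0.
have [d d0 dt] : exists2 d : R, 0 < d & t < spectral_cert_value b (- d)
  (fun i : 'I_k => d).
  have k1 : 1 <= k.+1%:R :> R by rewrite ler1n.
  have D0 : 0 < 2 * k.+1%:R :> R by rewrite mulr_gt0.
  have [d dE d0] : exists2 d : R, 2 * k.+1%:R * d = - t & 0 < d.
    exists (- t / (2 * k.+1%:R)); first by rewrite mulrC divfK // gt_eqF.
    by rewrite divr_gt0 // oppr_gt0.
  exists d => //; case: b => /=.
    have : 0 <= (k.+1%:R - 1) * d by rewrite mulr_ge0 ?subr_ge0 // ltW.
    lra.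
  have -> : \sum_(i < k) d = (k.+1%:R - 1) * d.
    by rewrite sumr_const card_ord -natr1 addrK mulr_natl.
  lra.
exists (- d), 0, (fun=> d); split => //.
- move=> v v0; rewrite trmx0 mul0mx addr0 sub0r scaleNr opprK bil_mxZ.
  by rewrite mulr_gt0 // gp.2.
- move=> i v v0; rewrite row0 trmx0 mul0mx subr0 bil_mxZ.
  by rewrite mulr_gt0 // gp.2.
Qed.

Lemma spectral_cert_near (T : topologicalType) b k n (g A : T -> 'M[R]_n) x t :
  (forall i j, {for x, continuous (fun y => g y i j)}) ->
  (forall i j, {for x, continuous (fun y => A y i j)}) ->
  spectral_cert b k (g x) (A x) t -> \forall y \near x,
    spectral_cert b k (g y) (A y) t.
Proof.
move=> gc Ac [s [Z [c [pA pc tc]]]].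
have N1 : \forall y \near x, pos (A y + Z^T *m Z - s *: g y).
  apply: (@pos_near R T n (fun y => A y + Z^T *m Z - s *: g y)) => // i j.
  rewrite (_ : (fun _ => _) = fun y => (A y i j + (Z^T *m Z) i j) + (- s)
    * g y i j).
    apply: continuous_atD; first by apply: continuous_atD => //;
      exact: continuous_at_cst.
    by apply: continuous_atM => //; exact: continuous_at_cst.
  by apply/funext => y; rewrite -scaleNr [LHS]mxE [X in X + _]mxE
    [X in _ + X]mxE.
have N2 : \forall y \near x, forall i,
  pos (c i *: g y - (row i Z)^T *m row i Z).
  have N2i i : \forall y \near x, pos (c i *: g y - (row i Z)^T *m row i Z).
    apply: (@pos_near R T n (fun y => c i *: g y - (row i Z)^T *m row i Z)) =>
      // a j.
    rewrite (_ : (fun _ => _) = fun y =>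
      c i * g y a j + (- ((row i Z)^T *m row i Z)) a j).
      apply: continuous_atD; last exact: continuous_at_cst.
      by apply: continuous_atM => //; exact: continuous_at_cst.
    by apply/funext => y; rewrite [LHS]mxE [X in X + _]mxE.
  exact: (filter_forall (nbhs_filter x) N2i).
by apply: filterS2 N1 N2 => y H1 H2; exists s, Z, c; split.
Qed.

Lemma spectral_funP b k n (g A : 'M[R]_n) t : posdef g -> A^T = A ->
  (k < n)%N ->
  t < spectral_fun b k.+1 (eigenvalues g A) <-> spectral_cert b k g A t.
Proof.
by move=> gp sA kn; split;
  [exact: spectral_cert_complete|exact: spectral_cert_sound].
Qed.

Lemma sym_congr m n (D : 'M[R]_(m, n)) (A : 'M[R]_n) :
  A^T = A -> (D *m A *m D^T)^T = D *m A *m D^T.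
Proof. by move=> sA; rewrite !trmx_mul trmxK sA mulmxA. Qed.

Lemma posdef_congr m n (D : 'M[R]_(m, n)) (g : 'M[R]_n) :
  row_free D -> posdef g -> posdef (D *m g *m D^T).
Proof.
move=> Df gp; split; first exact: sym_congr gp.1.
by move=> v v0; rewrite bil_congr gp.2 // mulmx_free_eq0.
Qed.

(** Restriction to a subspace does not decrease the spectral functions; D need
    not be square. *)
Lemma spectral_fun_congr b k m n (D : 'M[R]_(m, n)) (g A : 'M[R]_n) :
  row_free D -> posdef g -> A^T = A -> (k < m)%N ->
  spectral_fun b k.+1 (eigenvalues g A) <=
  spectral_fun b k.+1 (eigenvalues (D *m g *m D^T) (D *m A *m D^T)).
Proof.
move=> Df gp sA km; rewrite leNgt; apply/negP => /spectral_funP H.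
have kn : (k < n)%N by rewrite (leq_trans km) // -(eqP Df) rank_leq_col.
have := spectral_cert_congr Df (H gp sA kn).
move=> /(spectral_cert_sound (posdef_congr Df gp) (sym_congr D sA) km).
by rewrite ltxx.
Qed.

Lemma spectral_fun_shift b k n (g A A' : 'M[R]_n) e : 0 <= e -> posdef g ->
  A^T = A -> A'^T = A' -> (k < n)%N ->
  (forall v, bil A v v <= bil A' v v + e * bil g v v) ->
  spectral_fun b k.+1 (eigenvalues g A) <=
  spectral_fun b k.+1 (eigenvalues g A') + k.+1%:R * e.
Proof.
move=> e0 gp sA sA' kn AA'; rewrite leNgt; apply/negP => /spectral_funP H.
have := spectral_cert_shift e0 gp AA' (H gp sA kn); rewrite addrK.
by move=> /(spectral_cert_sound gp sA' kn); rewrite ltxx.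
Qed.

End SpectralFun.

(** * Changes of charts *)

Section Jacobians.
Context {R : realType}.

Lemma mul_jacobian m n (f : 'rV[R]_m -> 'rV[R]_n) p v :
  differentiable f p -> v *m jacobian f p = 'D_v f p.
Proof. by move=> df; rewrite deriveE // mul_rV_lin1. Qed.

Lemma mulmx_ext m n (A B : 'M[R]_(m, n)) :
  (forall v : 'rV[R]_m, v *m A = v *m B) -> A = B.
Proof. by move=> AB; apply/row_matrixP => i; rewrite !rowE. Qed.

(** Stated for a local left inverse g, as it is applied to both compositions of
    a change of charts with its inverse. *)
Lemma jacobian_inverse m n (f : 'rV[R]_m -> 'rV[R]_n) (g : 'rV[R]_n ->
  'rV[R]_m) p :
  differentiable f p -> differentiable g (f p) ->
  (\forall z \near p, g (f z) = z) ->
  jacobian f p *m jacobian g (f p) = 1%:M.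
Proof.
move=> df dg gf; apply: mulmx_ext => v.
rewrite mulmx1 mulmxA (mul_jacobian v df) (mul_jacobian _ dg) -derive_comp //.
rewrite (_ : 'D_v (g \o f) p = 'D_v id p); first exact: derive_id.
by apply: near_eq_derive; apply: filterS gf.
Qed.

End Jacobians.

Section Charts.
Context {R : realType}.

Lemma ccodP (T : topologicalType) n (a : chart R T n) y :
  ccod a y -> cdom a (cinv a y) /\ cmap a (cinv a y) = y.
Proof. by move=> [x ax <-]; rewrite cmapK. Qed.

Lemma ccod_cmap (T : topologicalType) n (a : chart R T n) x :
  cdom a x -> ccod a (cmap a x).
Proof. by move=> ax; exists x. Qed.

Lemma ccod_near (T : topologicalType) n (a : chart R T n) y :
  ccod a y -> nbhs y (ccod a).
Proof. by move=> ay; apply: open_nbhs_nbhs; split => //; exact: ccod_open. Qed.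

(** Images of open sets are domains of the local expressions of maps, on which
    the calculus of the first part applies. *)
Lemma chart_image_open (T : topologicalType) n (a : chart R T n) (W : set T) :
  open W -> open (cmap a @` (cdom a `&` W)).
Proof.
move=> oW; rewrite openE => _ [x [ax Wx] <-].
have N1 := ccod_near (ccod_cmap ax).
have N2 : \forall z \near cmap a x, W (cinv a z).
  apply: (cinv_cont (ccod_cmap ax)); rewrite cmapK //.
  exact: open_nbhs_nbhs.
apply: filterS2 N1 N2 => z /ccodP[az za] Wz.
by exists (cinv a z).
Qed.

End Charts.

Section ChartChanges.
Context {R : realType} {n : nat}.
Implicit Types M : manifold R n.

Lemma transition_differentiable M (a b : chart R M n) x :
  atlas a -> atlas b -> cdom a x -> cdom b x ->
  differentiable (cmap b \o cinv a) (cmap a x).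
Proof.
move=> aa ab ax bx.
apply: (Ck1_differentiable_mx _ (atlas_compat aa ab 1)).
  by apply: chart_image_open; exact: cdom_open.
by exists x.
Qed.

Lemma transition_jacobian M (a b : chart R M n) x :
  atlas a -> atlas b -> cdom a x -> cdom b x ->
  jacobian (cmap b \o cinv a) (cmap a x) *m
  jacobian (cmap a \o cinv b) (cmap b x) = 1%:M.
Proof.
move=> aa ab ax bx.
have E : (cmap b \o cinv a) (cmap a x) = cmap b x by rewrite /= cmapK.
rewrite -E; apply: jacobian_inverse; first exact: transition_differentiable.
  by rewrite E; exact: transition_differentiable.
have oI := @chart_image_open _ _ _ a _ (cdom_open b).
apply: filterS (open_nbhs_nbhs (conj oI _)); last by exists x.
by move=> _ [z [az bz] <-] /=; rewrite !cmapK.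
Qed.

Lemma to_preferred_unit M (a : chart R M n) x : atlas a -> cdom a x ->
  to_preferred a x \in unitmx.
Proof.
move=> aa ax; have := transition_jacobian aa (chart_at_atlas x) ax
  (chart_at_dom x).
by case/mulmx1_unit => u _; exact: u.
Qed.

Lemma form_in_chart_cmap M (B : M -> 'M[R]_n) (a : chart R M n) x : cdom a x ->
  form_in_chart B a (cmap a x) =
    to_preferred a x *m B x *m (to_preferred a x)^T.
Proof. by move=> ax; rewrite /form_in_chart cmapK. Qed.

Lemma endo_in_chart_cmap M (E : M -> 'M[R]_n) (a : chart R M n) x : cdom a x ->
  endo_in_chart E a (cmap a x) =
  to_preferred a x *m E x *m invmx (to_preferred a x).
Proof. by move=> ax; rewrite /endo_in_chart cmapK. Qed.

End ChartChanges.

(** * Open sets of 2-jets *)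

Section JetTopology.
Context {R : realType} {n : nat}.
Variable M : riemannian R n.
Implicit Types (a : chart R M n) (j : jet M).

Local Notation coords := ('rV[R]_n * R * 'rV[R]_n * 'M[R]_n)%type.

(** To prove that a set of jets is open, describe it in the bundle coordinates
    over each chart by a condition that is open at the points that satisfy
    it. *)
Lemma jet_open_coord (P : set (jet M)) (Q : chart R M n -> coords -> Prop) :
  (forall a j, atlas a -> cdom a (jpt j) -> (P j <-> Q a (jcoord a j))) ->
  (forall a j, atlas a -> cdom a (jpt j) -> Q a (jcoord a j) ->
     \forall c \near jcoord a j, Q a c) -> open P.
Proof.
move=> PQ nQ; suff : jet_open P by [].
move=> a aa j Pj aj; have := nQ a j aa aj ((PQ a j aa aj).1 Pj).
by apply: filterS => c Qc j' aj' jc; apply/(PQ a j' aa aj'); rewrite jc.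
Qed.

Lemma coord_chart_continuous (T : topologicalType) (h : 'rV[R]_n -> T)
  (c : coords) :
  {for c.1.1.1, continuous h} ->
    {for c, continuous (fun c : coords => h c.1.1.1)}.
Proof.
move=> hc; apply: (@continuous_comp _ _ _ (fun c : coords => c.1.1.1) h);
  last exact: hc.
apply: (@continuous_comp _ _ _ (fun c : coords => c.1.1) fst);
  last exact: cvg_fst.
apply: (@continuous_comp _ _ _ (fun c : coords => c.1) fst); exact: cvg_fst.
Qed.

Lemma coord_value_continuous (c : coords) :
  {for c, continuous (fun c : coords => c.1.1.2)}.
Proof.
apply: (@continuous_comp _ _ _ (fun c : coords => c.1.1) snd);
  last exact: cvg_snd.
apply: (@continuous_comp _ _ _ (fun c : coords => c.1) fst); exact: cvg_fst.
Qed.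

Lemma coord_grad_continuous (c : coords) i :
  {for c, continuous (fun c : coords => c.1.2 0 i : R)}.
Proof.
apply: (@continuous_comp _ _ _ (fun c : coords => c.1.2) (fun v : 'rV[R]_n =>
  v 0 i)); last exact: coord_continuous.
apply: (@continuous_comp _ _ _ (fun c : coords => c.1) snd);
  last exact: cvg_snd.
exact: cvg_fst.
Qed.

Lemma coord_hess_continuous (c : coords) i k :
  {for c, continuous (fun c : coords => c.2 i k : R)}.
Proof.
apply: (@continuous_comp _ _ _ snd (fun v : 'M[R]_n => v i k));
  last exact: coord_continuous.
exact: cvg_snd.
Qed.

Lemma form_metric_continuous a x i k : atlas a -> cdom a x ->
  {for cmap a x, continuous (fun y => form_in_chart (@metric R n M) a y i k)}.
Proof.
move=> aa ax; have [gc _] := metric_smooth aa 0.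
by have /mx_continuousP := gc _ (ccod_cmap ax); apply.
Qed.

Lemma metric_coord_continuous a j i k : atlas a -> cdom a (jpt j) ->
  {for jcoord a j, continuous (fun c : coords =>
     form_in_chart (@metric R n M) a c.1.1.1 i k)}.
Proof.
move=> aa aj.
apply: (@coord_chart_continuous _ (fun y =>
  form_in_chart (@metric R n M) a y i k)).
exact: form_metric_continuous.
Qed.

Lemma jval_lt_open t : open [set j : jet M | jval j < t].
Proof.
apply: (@jet_open_coord _ (fun _ c => c.1.1.2 < t)) => // a j aa aj jt.
exact: (coord_value_continuous (open_nbhs_nbhs (conj (@open_lt R t) jt))).
Qed.

Lemma jval_gt_open t : open [set j : jet M | t < jval j].
Proof.
apply: (@jet_open_coord _ (fun _ c => t < c.1.1.2)) => // a j aa aj jt.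
exact: (coord_value_continuous (open_nbhs_nbhs (conj (@open_gt R t) jt))).
Qed.

Lemma pos_congr m (D : 'M[R]_(m, n)) (B : 'M[R]_n) : row_free D ->
  pos B -> pos (D *m B *m D^T).
Proof. by move=> Df pB v v0; rewrite bil_congr pB // mulmx_free_eq0. Qed.

Lemma unit_congrK (D B : 'M[R]_n) : D \in unitmx ->
  invmx D *m (D *m B *m D^T) *m (invmx D)^T = B.
Proof.
move=> uD; rewrite !mulmxA mulVmx // mul1mx -mulmxA -trmx_mul mulVmx //.
by rewrite trmx1 mulmx1.
Qed.

Lemma unit_row_free (D : 'M[R]_n) : D \in unitmx -> row_free D.
Proof. by rewrite row_free_unit. Qed.

Lemma outer_congr (D : 'M[R]_n) (g : 'M[R]_n) (p : 'rV[R]_n) t :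
  D *m (t *: g - p^T *m p) *m D^T =
  t *: (D *m g *m D^T) - (p *m D^T)^T *m (p *m D^T).
Proof.
rewrite mulmxBr mulmxBl -scalemxAr -scalemxAl; congr (_ - _).
by rewrite trmx_mul trmxK !mulmxA.
Qed.

(** The dual norm of p is described here and in conorm_gtP without inverting
    the metric, by conditions that transform well under changes of charts and
    are visibly open. *)
Lemma conorm_ltP (x : M) p t : 0 < t ->
  conorm_at x p < t <-> pos (t ^+ 2 *: metric x - p^T *m p).
Proof.
move=> t0; have gp := metric_posdef x.
have -> : (conorm_at x p < t) = (bil (invmx (metric x)) p p < t ^+ 2).
  by rewrite /conorm_at -[in RHS](sqr_sqrtr (bil_invmx_ge0 p gp)) ltr_sqr //
    nnegrE ?sqrtr_ge0 // ltW.
split=> [pt v v0|H].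
  rewrite bil_mxD bil_mxN bil_mxZ bil_outer subr_gt0.
  apply: le_lt_trans (pairing_cauchy_schwarz p v gp) _.
  by rewrite ltr_pM2r // gp.2.
have [->|p0] := eqVneq p 0; first by rewrite bil0l exprn_gt0.
have v0 : p *m invmx (metric x) != 0.
  by rewrite mulmx_free_eq0 // row_free_unit unitmx_inv posdef_unit.
have := H _ v0; rewrite bil_mxD bil_mxN bil_mxZ bil_outer subr_gt0.
rewrite -bil_invmx // -/(bil (invmx (metric x)) p p) expr2 ltr_pM2r //.
by rewrite bil_invmx // gp.2.
Qed.

Lemma conorm_gtP (x : M) p t : 0 <= t ->
  t < conorm_at x p <->
  exists w, t ^+ 2 * bil (metric x) w w < (w *m p^T) 0 0 ^+ 2.
Proof.
move=> t0; have gp := metric_posdef x.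
have -> : (t < conorm_at x p) = (t ^+ 2 < bil (invmx (metric x)) p p).
  by rewrite /conorm_at -[in RHS](sqr_sqrtr (bil_invmx_ge0 p gp)) ltr_sqr //
    nnegrE ?sqrtr_ge0.
split=> [tp|[w H]].
  exists (p *m invmx (metric x)).
  rewrite -bil_invmx // -/(bil (invmx (metric x)) p p) expr2
    [ltRHS]expr2 ltr_pM2r //.
  by apply: le_lt_trans tp; exact: sqr_ge0.
have := lt_le_trans H (pairing_cauchy_schwarz p w gp).
by rewrite ltr_pM2r // gp.2 //; apply/eqP => w0; move: H;
  rewrite w0 bil0l mul0mx mxE expr0n mulr0 ltxx.
Qed.

Lemma conorm_lt_open t : open [set j : jet M | conorm_at (jpt j) (jgrad j) < t].
Proof.
have [t0|t0] := ltP 0 t; last first.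
  rewrite (_ : mkset _ = set0); first exact: open0.
  by apply/seteqP; split => // j /= /lt_le_trans/(_ t0);
    rewrite ltNge sqrtr_ge0.
apply: (@jet_open_coord _ (fun a c =>
  pos (t ^+ 2 *: form_in_chart (@metric R n M) a c.1.1.1 - c.1.2^T *m c.1.2))).
  move=> a j aa aj; rewrite /jcoord /= form_in_chart_cmap // -outer_congr.
  have uD := to_preferred_unit aa aj.
  split=> [/(conorm_ltP _ _ t0) H|H];
    first exact: pos_congr (unit_row_free uD) H.
  apply/(conorm_ltP _ _ t0); rewrite -[X in pos X](unit_congrK _ uD).
  by apply: pos_congr H; rewrite row_free_unit unitmx_inv.
move=> a j aa aj H.
apply: (@pos_near R coords n (fun c =>
  t ^+ 2 *: form_in_chart (@metric R n M) a c.1.1.1 - c.1.2^T *m c.1.2)) =>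
    // i k.
rewrite (_ : (fun _ => _) = fun c : coords =>
   t ^+ 2 * form_in_chart (@metric R n M) a c.1.1.1 i k + (- 1)
     * (c.1.2 0 i * c.1.2 0 k)).
  apply: (@continuous_atD R coords (fun c =>
    t ^+ 2 * form_in_chart (@metric R n M) a c.1.1.1 i k)
    (fun c => (- 1) * (c.1.2 0 i * c.1.2 0 k))).
    apply: (@continuous_atM R coords (fun=> t ^+ 2));
      first exact: continuous_at_cst.
    exact: metric_coord_continuous.
  apply: (@continuous_atM R coords (fun=> - 1)); first exact: continuous_at_cst.
  by apply: (@continuous_atM R coords (fun c => c.1.2 0 i) (fun c =>
    c.1.2 0 k)); exact: coord_grad_continuous.
apply/funext => c; rewrite [LHS]mxE [X in X + _]mxE [X in _ + X]mxE mulN1r.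
by congr (_ - _); rewrite mxE big_ord1 mxE.
Qed.

Lemma conorm_gt_open t : 0 <= t ->
  open [set j : jet M | t < conorm_at (jpt j) (jgrad j)].
Proof.
move=> t0.
apply: (@jet_open_coord _ (fun a c => exists w,
  t ^+ 2 * bil (form_in_chart (@metric R n M) a c.1.1.1) w w <
    (w *m c.1.2^T) 0 0 ^+ 2)).
  move=> a j aa aj; rewrite /jcoord /= form_in_chart_cmap //.
  have uD := to_preferred_unit aa aj.
  split=> [/(conorm_gtP _ _ t0)[w H]|[w H]].
    exists (w *m invmx (to_preferred a (jpt j))).
    by rewrite bil_congr trmx_mul trmxK mulmxA mulmxKV.
  apply/(conorm_gtP _ _ t0); exists (w *m to_preferred a (jpt j)).
  by rewrite bil_congr trmx_mul trmxK mulmxA in H.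
move=> a j aa aj [w H].
pose F (c : coords) := (w *m c.1.2^T) 0 0 ^+ 2 -
  t ^+ 2 * bil (form_in_chart (@metric R n M) a c.1.1.1) w w.
have Fc : {for jcoord a j, continuous F}.
  rewrite (_ : F = fun c =>
    (\sum_i w 0 i * c.1.2 0 i) * (\sum_i w 0 i * c.1.2 0 i) +
    (- t ^+ 2) * bil (form_in_chart (@metric R n M) a c.1.1.1) w w); last first.
    apply/funext => c; rewrite /F mulNr expr2; congr (_ * _ - _);
    by rewrite mxE; apply: eq_bigr => i _; rewrite mxE.
  have S : {for jcoord a j,
    continuous (fun c : coords => \sum_i w 0 i * c.1.2 0 i)}.
    apply: (@continuous_at_sum R coords _ (fun i c => w 0 i * c.1.2 0 i)) => i.
    apply: (@continuous_atM R coords (fun=> w 0 i));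
      first exact: continuous_at_cst.
    exact: coord_grad_continuous.
  apply: (@continuous_atD R coords); first exact: (@continuous_atM R coords).
  apply: (@continuous_atM R coords (fun=> - t ^+ 2));
    first exact: continuous_at_cst.
  apply: (@bil_continuous_at R coords n _ (fun=> w) (fun=> w)) => [i k|i|i].
  - exact: metric_coord_continuous.
  - exact: continuous_at_cst.
  - exact: continuous_at_cst.
have F0 : 0 < F (jcoord a j) by rewrite subr_gt0.
have N : \forall c \near jcoord a j, 0 < F c.
  exact: Fc _ (open_nbhs_nbhs (conj (@open_gt R 0) F0)).
by apply: filterS N => c; rewrite subr_gt0 => Hc; exists w.
Qed.

End JetTopology.

(** * The subequations and their duals *)

Section HermitianPart.
Context {R : realType}.

Lemma hermitian_part_sym n (J A : 'M[R]_n) : A^T = A ->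
  (hermitian_part J A)^T = hermitian_part J A.
Proof.
by move=> sA; rewrite /hermitian_part linearZ linearD /= sA sym_congr.
Qed.

Lemma hermitian_part_congr m n (JX : 'M[R]_m) (JY A : 'M[R]_n)
  (D : 'M[R]_(m, n)) :
  JX *m D = D *m JY ->
  hermitian_part JX (D *m A *m D^T) = D *m hermitian_part JY A *m D^T.
Proof.
move=> JD; rewrite /hermitian_part -scalemxAr -scalemxAl; congr (_ *: _).
rewrite mulmxDr mulmxDl; congr (_ + _).
have JDt : D^T *m JX^T = JY^T *m D^T by rewrite -!trmx_mul JD.
by rewrite !mulmxA JD -!mulmxA JDt.
Qed.

Lemma hermitian_part1 n (A : 'M[R]_n) : hermitian_part 1%:M A = A.
Proof.
rewrite /hermitian_part mul1mx trmx1 mulmx1; apply/matrixP => i j.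
by rewrite !mxE; field.
Qed.

Lemma hermitian_partD n (J A B : 'M[R]_n) :
  hermitian_part J (A + B) = hermitian_part J A + hermitian_part J B.
Proof. by rewrite /hermitian_part mulmxDr mulmxDl addrACA scalerDr. Qed.

Lemma hermitian_partN n (J A : 'M[R]_n) :
  hermitian_part J (- A) = - hermitian_part J A.
Proof. by rewrite /hermitian_part mulmxN mulNmx -opprD scalerN. Qed.

Lemma bil_hermitian_part n (J A : 'M[R]_n) v :
  bil (hermitian_part J A) v v = 2^-1 * (bil A v v + bil A (v *m J) (v *m J)).
Proof. by rewrite /hermitian_part bil_mxZ bil_mxD bil_congr. Qed.

End HermitianPart.

Section SpectrumTopology.
Context {R : realType} {n : nat}.
Variables (M : riemannian R n) (J : M -> 'M[R]_n).
Hypothesis J_continuous : forall a, atlas a -> forall y, ccod a y ->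
  {for y, continuous (endo_in_chart J a)}.

Local Notation coords := ('rV[R]_n * R * 'rV[R]_n * 'M[R]_n)%type.

Definition spec_at (b : spectral_kind) (k : nat) (j : jet M) : R :=
  spectral_fun b k
    (eigenvalues (metric (jpt j)) (hermitian_part (J (jpt j)) (jhess j))).

(** In bundle coordinates, the certificate is one for the matrix of the metric,
    which depends continuously on the point. *)
Lemma spec_gt_open b k t : (k < n)%N -> open [set j | t < spec_at b k.+1 j].
Proof.
move=> kn; apply: (@jet_open_coord _ _ M _ (fun a c =>
  spectral_cert b k (form_in_chart (@metric R n M) a c.1.1.1)
    (hermitian_part (endo_in_chart J a c.1.1.1) c.2) t)).
  move=> a j aa aj; rewrite /jcoord /= form_in_chart_cmap // endo_in_chart_cmap
    //.
  have uD := to_preferred_unit aa aj; set D := to_preferred a _ in uD *.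
  rewrite (@hermitian_part_congr _ _ _ _ (J (jpt j))); last by rewrite mulmxKV.
  have sA := hermitian_part_sym (J (jpt j)) (jhess_sym j).
  have gp := metric_posdef (jpt j).
  split=> [/(spectral_funP _ _ gp sA kn)|] H.
    exact: spectral_cert_congr (unit_row_free uD) H.
  apply/(spectral_funP _ _ gp sA kn).
  rewrite -(unit_congrK (metric _) uD)
    -[X in spectral_cert _ _ _ X _](unit_congrK _ uD).
  by apply: spectral_cert_congr H; apply: unit_row_free; rewrite unitmx_inv.
move=> a j aa aj; apply: (@spectral_cert_near R coords b k n
  (fun c => form_in_chart (@metric R n M) a c.1.1.1)
  (fun c => hermitian_part (endo_in_chart J a c.1.1.1) c.2)) => i l.
  exact: metric_coord_continuous.
have Ec p q : {for jcoord a j,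
  continuous (fun c : coords => endo_in_chart J a c.1.1.1 p q)}.
  apply: (@coord_chart_continuous _ _ _ (fun y => endo_in_chart J a y p q)).
  by have /mx_continuousP := J_continuous aa (ccod_cmap aj); apply.
rewrite (_ : (fun _ => _) = fun c : coords => 2^-1 * (c.2 i l +
  \sum_q (\sum_p endo_in_chart J a c.1.1.1 i p * c.2 p q)
    * endo_in_chart J a c.1.1.1 l q)).
  apply: (@continuous_atM R coords (fun=> 2^-1));
    first exact: continuous_at_cst.
  apply: (@continuous_atD R coords (fun c => c.2 i l));
    first exact: coord_hess_continuous.
  apply: (@continuous_at_sum R coords) => q.
  apply: (@continuous_atM R coords); last exact: Ec.
  apply: (@continuous_at_sum R coords _ (fun p c =>
    endo_in_chart J a c.1.1.1 i p * c.2 p q)) => p.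
  apply: (@continuous_atM R coords (fun c => endo_in_chart J a c.1.1.1 i p));
    first exact: Ec.
  exact: coord_hess_continuous.
apply/funext => c; rewrite /hermitian_part [LHS]mxE [X in _ * X]mxE;
  congr (_ * (_ + _)).
by rewrite mxE; apply: eq_bigr => q _; rewrite [X in X * _]mxE [X in _ * X]mxE.
Qed.

(** The real subequation is the case where J is the identity (F_real_twisted),
    the complex one the case where J is the almost complex structure. *)
Definition F_twisted (b : spectral_kind) (k : nat) (f : R -> R) : set (jet M) :=
  [set j | f (jval j) <= spec_at b k j].

(** If the bound failed, the opposite jet would have a neighbourhood, cut out by
    the values below -c and the spectral functions above f(-c), inside F. *)
Lemma F_twisted_dualP b k f (c : R) (j : jet M) : (k < n)%N ->
  {homo f : r s / r <= s} -> dirichlet_dual (F_twisted b k.+1 f) j ->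
    c < jval j ->
  spec_at b k.+1 (jet_opp j) <= f (- c).
Proof.
move=> kn fm Fj cj; rewrite leNgt; apply/negP => H; apply: Fj.
pose O := [set i : jet M | jval i < - c] `&` [set i |
  f (- c) < spec_at b k.+1 i].
have oO : open O by apply: openI; [exact: jval_lt_open|exact: spec_gt_open].
have OF : O `<=` F_twisted b k.+1 f.
  by move=> i [/= ic /ltW]; apply: le_trans; apply: fm; exact: ltW.
apply: (filterS OF); apply: open_nbhs_nbhs; split => //.
by split => //=; rewrite ltrN2.
Qed.

(** A jet outside F is all the more outside its interior. *)
Lemma F_twisted_dual_intro b k f (j : jet M) :
  spec_at b k (jet_opp j) < f (- jval j) -> dirichlet_dual (F_twisted b k f) j.
Proof.
by move=> H /interior_subset /=; rewrite /F_twisted /= leNgt H.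
Qed.

Lemma conorm_opp (x : M) p : conorm_at x (- p) = conorm_at x p.
Proof. by rewrite /conorm_at -scaleN1r bilZl bilZr mulrA mulrNN !mulr1 mul1r.
  Qed.

Lemma E_xi_dualP xi (c : R) (j : jet M) : {homo xi : r s / r <= s >-> s <= r} ->
  dirichlet_dual (E_xi M xi) j -> c < jval j ->
  xi (- c) <= conorm_at (jpt j) (jgrad j).
Proof.
move=> xim Ej cj; rewrite leNgt; apply/negP => H; apply: Ej.
pose O := [set i : jet M | jval i < - c] `&`
  [set i : jet M | conorm_at (jpt i) (jgrad i) < xi (- c)].
have oO : open O by apply: openI; [exact: jval_lt_open|exact: conorm_lt_open].
have OE : O `<=` E_xi M xi.
  move=> i [/= ic ix]; apply: subset_closure => /=.
  by apply: lt_le_trans ix _; apply: xim; exact: ltW.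
apply: (filterS OE); apply: open_nbhs_nbhs; split => //.
by split => //=; rewrite ?ltrN2 // conorm_opp.
Qed.

(** The jets of value above -c and of gradient longer than xi(-c) form an open
    set that does not meet the set of which E_xi is the closure. *)
Lemma E_xi_dual_intro xi (c : R) (j : jet M) :
  {homo xi : r s / r <= s >-> s <= r} ->
  0 <= xi (- c) -> jval j < c -> xi (- c) < conorm_at (jpt j) (jgrad j) ->
  dirichlet_dual (E_xi M xi) j.
Proof.
move=> xim xi0 jc H /interior_subset; rewrite /E_xi => clj.
pose O := [set i : jet M | - c < jval i] `&`
  [set i : jet M | xi (- c) < conorm_at (jpt i) (jgrad i)].
have oO : open O by apply: openI; [exact: jval_gt_open|exact: conorm_gt_open].
have Oj : O (jet_opp j) by split => /=; rewrite ?ltrN2 ?conorm_opp.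
have [i [/= ix [/= ic xic]]] := clj _ (open_nbhs_nbhs (conj oO Oj)).
have := lt_le_trans (lt_trans xic ix) (xim _ _ (ltW ic)).
by rewrite ltxx.
Qed.

End SpectrumTopology.

(** * Christoffel symbols and Hessians *)

Section Linearity.
Context {R : realType}.

Lemma linear_row_sum (V : lmodType R) n (L : 'rV[R]_n -> V) v : linear L ->
  L v = \sum_i v 0 i *: L (basis_vec i).
Proof.
move=> Llin; pose LL : {linear 'rV[R]_n -> V} :=
  HB.pack L (GRing.isLinear.Build _ _ _ _ L Llin).
rewrite -[L]/(LL : _ -> _) [in LHS](row_sum_basis v) linear_sum.
by apply: eq_bigr => i _; rewrite linearZ.
Qed.

Lemma row_bil_linear n p (N : 'I_p -> 'M[R]_n) c u v w :
  \row_l bil (N l) (c *: u + v) w =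
  c *: (\row_l bil (N l) u w) + \row_l bil (N l) v w.
Proof. by apply/rowP => l; rewrite !mxE bilDl bilZl. Qed.

Lemma scaler_comb3 (V : lmodType R) c (A1 A2 B1 B2 C1 C2 : V) :
  (c *: A1 + A2) + (c *: B1 + B2) - (c *: C1 + C2) =
  c *: (A1 + B1 - C1) + (A2 + B2 - C2).
Proof. by rewrite scalerBr scalerDr opprD (addrACA (c *: A1)) [LHS]addrACA. Qed.

Lemma derive_linear (V W : normedModType R) (f : V -> W) y : differentiable f y
  ->
  linear (fun v => 'D_v f y).
Proof. by move=> df a u v; rewrite !deriveE // linearP. Qed.

End Linearity.

Section Christoffel.
Context {R : realType} {n : nat}.
Variables (M : riemannian R n) (a : chart R M n) (y : 'rV[R]_n).
Hypotheses (aa : atlas a) (ay : ccod a y).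
Let G := form_in_chart (@metric R n M) a.

Lemma metric_chart_differentiable : differentiable G y.
Proof.
apply: (@Ck1_differentiable_mx R n n n (ccod a) G 0) ay; first exact: ccod_open.
exact: metric_smooth aa 1%N.
Qed.

(** Makes the Christoffel symbols symmetric, which is the vanishing of the
    torsion. *)
Lemma metric_chart_derive_sym v : ('D_v G y)^T = 'D_v G y.
Proof.
have dG : derivable G y v by apply: diff_derivable;
  exact: metric_chart_differentiable.
have E i j : (fun z => G z j i) = (fun z => G z i j).
  apply/funext => z; rewrite /G /form_in_chart.
  by rewrite -[in LHS](sym_congr _ (metric_posdef (cinv a z)).1) mxE.
by rewrite (derive_mx dG); apply/matrixP => i j; rewrite !mxE E.
Qed.

Lemma christoffelE v w : christoffel a y v w =
  2^-1 *: (w *m 'D_v G y + v *m 'D_w G y - \row_l bil ('D_(basis_vec l) G y) v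
    w)
  *m invmx (G y).
Proof. by []. Qed.

Lemma christoffel_sym v w : christoffel a y v w = christoffel a y w v.
Proof.
have E : \row_l bil ('D_(basis_vec l) G y) v w =
  \row_l bil ('D_(basis_vec l) G y) w v.
  apply/rowP => l; rewrite [LHS]mxE [RHS]mxE.
  by apply: bil_sym; exact: metric_chart_derive_sym.
rewrite (christoffelE v w) (christoffelE w v) E.
move: ('D_v G y) ('D_w G y) (\row_l _) (invmx _) => P Q r K.
by rewrite [w *m P + _]addrC.
Qed.

Lemma christoffel_linear w : linear (fun v => christoffel a y v w).
Proof.
move=> c u v; rewrite !christoffelE (derive_linear metric_chart_differentiable).
have E : \row_l bil ('D_(basis_vec l) G y) (c *: u + v) w =
    c *: (\row_l bil ('D_(basis_vec l) G y) u w) + \row_l bil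
      ('D_(basis_vec l) G y) v w.
  exact: row_bil_linear.
rewrite E.
move: ('D_u G y) ('D_v G y) ('D_w G y) (\row_l _) (\row_l _) (invmx _) =>
  P Q T r s K.
rewrite scalemxAl -mulmxDl; congr (_ *m _).
rewrite mulmxDr mulmxDl -!scalemxAr -!scalemxAl.
by apply/rowP => l; rewrite !mxE; ring.
Qed.

Lemma christoffel_linearr v : linear (christoffel a y v).
Proof.
move=> c u w; rewrite christoffel_sym (christoffel_linear v c u w).
by rewrite [christoffel a y u v]christoffel_sym
  [christoffel a y w v]christoffel_sym.
Qed.

Lemma christoffel_sum v w : christoffel a y v w =
  \sum_i \sum_j (v 0 i * w 0 j) *: christoffel a y (basis_vec i) (basis_vec j).
Proof.
rewrite (linear_row_sum v (christoffel_linear w)); apply: eq_bigr => i _.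
rewrite (linear_row_sum w (christoffel_linearr _)) scaler_sumr.
by apply: eq_bigr => j _; rewrite scalerA.
Qed.

End Christoffel.

Section Hessian.
Context {R : realType} {n : nat}.
Variables (M : riemannian R n).

Lemma hessian_sym (phi : M -> R) x : C2_near phi x ->
  (hessian phi x)^T = hessian phi x.
Proof.
move=> [V [oV Vx Vc fC]]; apply/matrixP => i j; rewrite !mxE.
rewrite (second_derivatives_commute _ _ oV fC Vx); congr (_ - derive _ _ _).
by apply: christoffel_sym; [exact: chart_at_atlas|exact: Vc].
Qed.

Lemma C2_near_differentiable (phi : M -> R) x : C2_near phi x ->
  differentiable (phi \o cinv (chart_at x)) (cmap (chart_at x) x).
Proof. by move=> [V [oV Vx _ fC]]; exact: Ck1_differentiable fC Vx. Qed.

Lemma pairing_gradient (phi : M -> R) x w : C2_near phi x ->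
  (w *m (gradient phi x)^T) 0 0 = 'D_w (phi \o cinv (chart_at x))
    (cmap (chart_at x) x).
Proof.
move=> /C2_near_differentiable df; rewrite derive_sum_basis // mxE.
by apply: eq_bigr => i _; rewrite !mxE.
Qed.

End Hessian.

Lemma open_preimage_on (T S : topologicalType) (f : T -> S) (U : set T)
  (O : set S) :
  open U -> open O -> (forall x, U x -> {for x, continuous f}) ->
  open (U `&` f @^-1` O).
Proof.
move=> oU oW fc; rewrite openE => x [Ux Ox].
have N1 := open_nbhs_nbhs (conj oU Ux).
have N2 : \forall y \near x,
  O (f y) by exact: fc Ux _ (open_nbhs_nbhs (conj oW Ox)).
by apply: filterS2 N1 N2.
Qed.

Section Pullback.
Context {R : realType} {m n : nat}.
Variables (X : riemannian R m) (Y : riemannian R n) (sigma : X -> Y).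
Hypothesis smooth_sigma : smooth_map sigma.
Variable x : X.

Let a := chart_at x.
Let b := chart_at (sigma x).
Let z := cmap a x.
Let S := in_charts sigma a b.
Let U := cmap a @` (cdom a `&` sigma @^-1` cdom b).

Lemma chart_domain_open : open U.
Proof.
apply: chart_image_open.
have [sc _] := smooth_sigma.
by apply: open_comp (cdom_open b) => y _; exact: sc.
Qed.

Lemma chart_domain_pt : U z.
Proof. by exists x => //; split; [exact: chart_at_dom|exact: chart_at_dom]. Qed.

Lemma in_charts_pt : S z = cmap b (sigma x).
Proof. by rewrite /S /in_charts cmapK //; exact: chart_at_dom. Qed.

Lemma in_charts_Ck k : Ck_on k U S.
Proof.
have [_ ss] := smooth_sigma.
by apply: ss; exact: chart_at_atlas.
Qed.

Lemma in_charts_differentiable y : U y -> differentiable S y.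
Proof. exact: Ck1_differentiable_mx chart_domain_open (in_charts_Ck 1). Qed.

Lemma differentialE v : v *m differential sigma x = 'D_v S z.
Proof. by apply: mul_jacobian;
  exact: in_charts_differentiable chart_domain_pt. Qed.

Lemma second_fundamental_form_linear w :
  linear (fun v => second_fundamental_form sigma x v w).
Proof.
move=> c u v; rewrite /second_fundamental_form -/a -/b -/S -/z.
have dS := in_charts_differentiable chart_domain_pt.
have dwS : differentiable (fun y => 'D_w S y) z.
  exact: Ck1_differentiable_mx chart_domain_open
    (Ck_on_derive w (in_charts_Ck 2)) chart_domain_pt.
have az : ccod a z by apply: ccod_cmap; exact: chart_at_dom.
have bz : ccod b (cmap b (sigma x)) by apply: ccod_cmap; exact: chart_at_dom.
rewrite (derive_linear dwS) (derive_linear dS c u v).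
rewrite (christoffel_linear (chart_at_atlas _) bz).
rewrite (christoffel_linear (chart_at_atlas _) az).
rewrite (derive_linear dS).
exact: scaler_comb3.
Qed.

Lemma second_fundamental_form_linearr v :
  linear (second_fundamental_form sigma x v).
Proof.
move=> c u w; rewrite /second_fundamental_form -/a -/b -/S -/z.
have dS := in_charts_differentiable chart_domain_pt.
have dwS t : derivable (fun y => 'D_t S y) z v.
  exact: Ck_on_derivable (Ck_on_derive t (in_charts_Ck 2)) chart_domain_pt.
have az : ccod a z by apply: ccod_cmap; exact: chart_at_dom.
have bz : ccod b (cmap b (sigma x)) by apply: ccod_cmap; exact: chart_at_dom.
have -> : 'D_v (fun y => 'D_(c *: u + w) S y) z =
    c *: 'D_v (fun y => 'D_u S y) z + 'D_v (fun y => 'D_w S y) z.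
  rewrite -deriveZ // -deriveD //; last exact: derivableZ.
  apply: near_eq_derive;
    apply: (near_open chart_domain_open chart_domain_pt) => y Uy.
  exact: (derive_linear (in_charts_differentiable Uy)).
rewrite (derive_linear dS c u w).
rewrite (christoffel_linearr (chart_at_atlas _) bz).
rewrite (christoffel_linearr (chart_at_atlas _) az).
rewrite (derive_linear dS).
exact: scaler_comb3.
Qed.

Variable phi : Y -> R.
Hypothesis C2phi : C2_near phi (sigma x).
Let f : 'rV[R]_n -> R := phi \o cinv b.

Lemma pullback_chart : exists (U' : set 'rV[R]_m) (W : set 'rV[R]_n),
  [/\ open U', open W, U' z, U' `<=` U & [/\ W (S z), Ck_on 2 W f,
   forall y, U' y -> W (S y) &
   forall y, U' y -> (phi \o sigma \o cinv a) y = (f \o S) y]].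
Proof.
have [W [oW Wz Wc fC]] := C2phi.
exists (U `&` S @^-1` W), W; split => //.
- apply: open_preimage_on => //; first exact: chart_domain_open.
  by move=> y Uy; exact: Ck_on_continuous (in_charts_Ck 0) Uy.
- by split; [exact: chart_domain_pt|rewrite /= in_charts_pt].
split => //; first by rewrite in_charts_pt.
  by move=> y [].
by move=> y [[w [aw bw] <-] _]; rewrite /f /S /in_charts /= !cmapK.
Qed.

Lemma pullback_C2_near : C2_near (phi \o sigma) x.
Proof.
have [U' [W [oU' oW Uz U'U [Wz fC SW E]]]] := pullback_chart.
exists U'; split => //.
  by move=> y /U'U[w [aw _] <-]; exact: ccod_cmap.
apply: (Ck_on_eq oU' (f := f \o S)); first by move=> y Uy; rewrite -E.
apply: Ck_on_comp oU' oW SW _ fC.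
exact: Ck_on_sub U'U (in_charts_Ck 2).
Qed.

Lemma pullback_derive v :
  'D_v (phi \o sigma \o cinv a) z = 'D_('D_v S z) f (cmap b (sigma x)).
Proof.
have [U' [W [oU' oW Uz U'U [Wz fC SW E]]]] := pullback_chart.
rewrite (near_eq_derive _ (near_open oU' Uz E)) -in_charts_pt derive_comp //.
  exact: in_charts_differentiable chart_domain_pt.
exact: Ck1_differentiable fC Wz.
Qed.

Lemma pullback_gradient :
  gradient (phi \o sigma) x =
    gradient phi (sigma x) *m (differential sigma x)^T.
Proof.
apply/rowP => i; rewrite [LHS]mxE -/a -/z pullback_derive -pairing_gradient //.
rewrite -differentialE /basis_vec -rowE !mxE; apply: eq_bigr => j _.
by rewrite !mxE mulrC.
Qed.

(** Differentiating phi o sigma twice yields the second derivatives of phi along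
    the differential of sigma and the derivative of phi along the second
    derivatives of sigma. The corrections by the Christoffel symbols of Y and
    of X turn these into the Hessian of phi and the second fundamental form
    respectively. *)
Lemma pullback_hessian :
  hessian (phi \o sigma) x =
  differential sigma x *m hessian phi (sigma x) *m (differential sigma x)^T +
  \matrix_(i, j) (second_fundamental_form sigma x (basis_vec i) (basis_vec j)
                  *m (gradient phi (sigma x))^T) 0 0.
Proof.
have [U' [W [oU' oW Uz U'U [Wz fC SW E]]]] := pullback_chart.
have dS y : U' y -> differentiable S y by move=> /U'U;
  exact: in_charts_differentiable.
have df : differentiable f (cmap b (sigma x)) by exact: C2_near_differentiable.
have bz : ccod b (cmap b (sigma x)) by apply: ccod_cmap; exact: chart_at_dom.
apply/matrixP => i j; rewrite [LHS]mxE [RHS]mxE [X in _ = _ + X]mxE.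
rewrite pairing_gradient // -/a -/b -/z -/f pullback_derive.
have -> : 'D_(basis_vec i) (fun y =>
  'D_(basis_vec j) (phi \o sigma \o cinv a) y) z =
    'D_(basis_vec i) (fun y => 'D_(basis_vec j) (f \o S) y) z.
  apply: near_eq_derive; apply: (near_open oU' Uz) => y Uy.
  by apply: near_eq_derive; exact: near_open E.
rewrite (derive2_comp _ _ oU' oW SW Uz (Ck_on_sub U'U (in_charts_Ck 2)) fC).
rewrite -bil_rows !rowE -/(basis_vec i) -/(basis_vec j) !differentialE bil_sum.
rewrite in_charts_pt.
set Si := 'D_(basis_vec i) S z; set Sj := 'D_(basis_vec j) S z.
have -> : \sum_k \sum_l Si 0 k * hessian phi (sigma x) k l * Sj 0 l =
  \sum_k \sum_l Si 0 k * Sj 0 l *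
     'D_(basis_vec k) (fun y => 'D_(basis_vec l) f y) (cmap b (sigma x)) -
  'D_(christoffel b (cmap b (sigma x)) Si Sj) f (cmap b (sigma x)).
  rewrite (christoffel_sum (chart_at_atlas _) bz) deriveE // linear_sum -sumrB.
  apply: eq_bigr => k _; rewrite linear_sum -sumrB; apply: eq_bigr => l _.
  by rewrite linearZ -deriveE // mxE -/b -/f -[X in _ = _ - X]/(_ * _); ring.
rewrite /second_fundamental_form -/a -/b -/z -/S -/Si -/Sj.
have dDB u v w : 'D_(u + v - w) f (cmap b (sigma x)) =
  'D_u f (cmap b (sigma x)) +
    'D_v f (cmap b (sigma x)) - 'D_w f (cmap b (sigma x)).
  by rewrite !deriveE // linearB linearD.
have arith (p q r s : R) : p + q - r = q - s + (p + s - r) by ring.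
by rewrite dDB -arith.
Qed.

End Pullback.

(** * Transfer of 2-jets along an isometric immersion *)

Section Constants.
Context {R : realType} {n : nat} (M : riemannian R n).

Lemma C2_near_addc (g : M -> R) c x : C2_near g x ->
  C2_near (fun y => g y + c) x.
Proof.
move=> [V [oV Vx Vc gC]]; exists V; split; [exact: oV|exact: Vx|exact: Vc|].
exact: (Ck_onD oV gC (Ck_on_cst 2 V c)).
Qed.

Lemma gradient_addc (g : M -> R) c x : gradient (fun y => g y + c) x =
  gradient g x.
Proof. by apply/rowP => i; rewrite !mxE; exact: derive_addc. Qed.

Lemma hessian_addc (g : M -> R) c x : hessian (fun y => g y + c) x =
  hessian g x.
Proof.
apply/matrixP => i j; rewrite !mxE.
set f := g \o cinv (chart_at x).
have -> : (fun y => g y + c) \o cinv (chart_at x) = fun z => f z + c by [].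
have E : (fun z => 'D_(basis_vec j) (fun z => f z + c) z) = 'D_(basis_vec j) f.
  by apply/funext => z; exact: derive_addc.
by rewrite E derive_addc.
Qed.

Lemma gradient_cst (r : R) (x : M) : gradient (fun=> r) x = 0.
Proof. by apply/rowP => i; rewrite !mxE; exact: derive_cst. Qed.

Lemma hessian_cst (r : R) (x : M) : hessian (fun=> r) x = 0.
Proof.
apply/matrixP => i j; rewrite !mxE.
have -> : (fun=> r) \o cinv (chart_at x) = cst r by [].
have -> : (fun z => 'D_(basis_vec j) (cst r) z) = cst 0.
  by apply/funext => z; exact: derive_cst.
by rewrite !derive_cst subrr.
Qed.

Lemma C2_near_cst (r : R) (x : M) : C2_near (fun=> r) x.
Proof.
exists (ccod (chart_at x)); split => //; first exact: ccod_open.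
  by apply: ccod_cmap; exact: chart_at_dom.
exact: Ck_on_cst.
Qed.

End Constants.

Section Transfer.
Context {R : realType} {m n : nat}.
Variables (X : riemannian R m) (Y : riemannian R n) (sigma : X -> Y).
Hypothesis imm : isometric_immersion sigma.
Let smooth_sigma : smooth_map sigma.
Proof. by case: imm. Qed.
Let free_diff x : row_free (differential sigma x).
Proof. by case: imm. Qed.
Let isom x : differential sigma x *m metric (sigma x) *m
  (differential sigma x)^T = metric x.
Proof. by case: imm => _ _ /(_ x). Qed.

Lemma second_fundamental_form_bil (x : X) (q : 'rV[R]_n) v :
  bil (\matrix_(i, j) (second_fundamental_form sigma x (basis_vec i)
    (basis_vec j)
                  *m q^T) 0 0) v v =
  (second_fundamental_form sigma x v v *m q^T) 0 0.
Proof.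
rewrite bil_sum (linear_row_sum v
  (second_fundamental_form_linear smooth_sigma x v)).
rewrite mulmx_suml summxE; apply: eq_bigr => i _.
rewrite (linear_row_sum v (second_fundamental_form_linearr smooth_sigma x _)).
rewrite -scalemxAl mulmx_suml mxE summxE mulr_sumr; apply: eq_bigr => j _.
by rewrite -scalemxAl !mxE; ring.
Qed.

(** The restriction of a covector to a subspace is not longer: test it on the
    vector of X that represents it. *)
Lemma conorm_pullback (x : X) (q : 'rV[R]_n) :
  conorm_at x (q *m (differential sigma x)^T) <= conorm_at (sigma x) q.
Proof.
have gX := metric_posdef x; have gY := metric_posdef (sigma x).
rewrite /conorm_at ler_sqrt ?bil_invmx_ge0 //.
set D := differential sigma x; set q' := q *m D^T.
have [->|q0] := eqVneq q' 0; first by rewrite bil0l bil_invmx_ge0.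
pose v := q' *m invmx (metric x).
have v0 : v != 0 by rewrite mulmx_free_eq0 // row_free_unit unitmx_inv
  posdef_unit.
have Q0 := gX.2 _ v0.
have := pairing_cauchy_schwarz q (v *m D) gY.
rewrite -bil_congr isom.
have -> : v *m D *m q^T = v *m q'^T by rewrite /q' trmx_mul trmxK mulmxA.
rewrite -/(bil (invmx (metric x)) q' q') bil_invmx // -/v expr2 ler_pM2r //.
Qed.

Variables (C : R).
Hypothesis C0 : 0 <= C.
Hypothesis bounded : forall (x : X) v w,
  norm_at (sigma x) (second_fundamental_form sigma x v w)
    <= C * norm_at x v * norm_at x w.

Lemma second_fundamental_form_bound (x : X) (q : 'rV[R]_n) v :
  `|(second_fundamental_form sigma x v v *m q^T) 0 0| <=
  C * conorm_at (sigma x) q * bil (metric x) v v.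
Proof.
have gX := metric_posdef x; have gY := metric_posdef (sigma x).
set w := second_fundamental_form _ _ _ _.
have H : `|(w *m q^T) 0 0| <= conorm_at (sigma x) q * norm_at (sigma x) w.
  rewrite -ler_sqr ?nnegrE ?mulr_ge0 ?sqrtr_ge0 // real_normK ?num_real //.
  rewrite exprMn !sqr_sqrtr ?bil_invmx_ge0 ?posdef_ge0 //.
  exact: pairing_cauchy_schwarz.
apply: le_trans H _; rewrite mulrAC [leRHS]mulrC ler_wpM2l ?sqrtr_ge0 //.
apply: le_trans (bounded _ _ _) _; rewrite -mulrA ler_wpM2l //.
by rewrite -expr2 sqr_sqrtr // posdef_ge0.
Qed.

Variables (JX : X -> 'M[R]_m) (JY : Y -> 'M[R]_n).
Hypothesis JX_isometry : forall x, JX x *m metric x *m (JX x)^T = metric x.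
Hypothesis JX_cont : forall a, atlas a -> forall y, ccod a y ->
  {for y, continuous (endo_in_chart JX a)}.
Hypothesis JY_cont : forall a, atlas a -> forall y, ccod a y ->
  {for y, continuous (endo_in_chart JY a)}.
Hypothesis JD : forall x,
  JX x *m differential sigma x = differential sigma x *m JY (sigma x).

Variables (b : spectral_kind) (k : nat) (k_lt_m : (k < m)%N) (f xi : R -> R).
Hypothesis f_homo : {homo f : r s / r <= s}.
Hypothesis xi_homo : {homo xi : r s / r <= s >-> s <= r}.

(** Restrict -Hess(phi) to the tangent space of X; there it differs from
    -Hess(phi o sigma) by dphi(II), which is at most C e g. *)
Lemma spec_pullback (x : X) (phi : Y -> R) (jX : jet X) (jY : jet Y) e :
  0 <= e -> C2_near phi (sigma x) ->
  jpt jX = x -> jhess jX = hessian (phi \o sigma) x ->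
  jpt jY = sigma x -> jgrad jY = gradient phi (sigma x) ->
  jhess jY = hessian phi (sigma x) ->
  conorm_at (sigma x) (gradient phi (sigma x)) <= e ->
  spec_at JY b k.+1 (jet_opp jY) <=
  spec_at JX b k.+1 (jet_opp jX) + k.+1%:R * (C * e).
Proof.
move=> e0 C2phi; case: jX => x' rX pX AX sX /= -> {x'} EX.
case: jY => y' rY pY AY sY /= -> {y'} EpY EY ce.
rewrite /spec_at /=.
set D := differential sigma x.
have sN (p : nat) (A : 'M[R]_p) : A^T = A -> (- A)^T = - A.
  by move=> sA; rewrite linearN /= sA.
apply: le_trans (spectral_fun_congr b (free_diff x) (metric_posdef _)
  (hermitian_part_sym _ (sN _ _ sY)) k_lt_m) _.
rewrite isom -(hermitian_part_congr _ (JD x)).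
apply: spectral_fun_shift => //.
- exact: mulr_ge0.
- exact: metric_posdef.
- by apply: hermitian_part_sym; apply: sym_congr; exact: sN.
- by apply: hermitian_part_sym; exact: sN.
move=> v; rewrite EX (pullback_hessian smooth_sigma C2phi) -EY -/D.
set N := \matrix_(i, j) _.
rewrite mulmxN mulNmx !hermitian_partN hermitian_partD !bil_mxN bil_mxD opprD.
rewrite -addrA lerDl addrC subr_ge0 bil_hermitian_part.
have Nb w : bil N w w <= C * e * bil (metric x) w w.
  rewrite second_fundamental_form_bil; apply: le_trans (ler_norm _) _.
  apply: le_trans (second_fundamental_form_bound _ _ _) _.
  by rewrite ler_wpM2r ?posdef_ge0 ?ler_wpM2l //; exact: metric_posdef.
have := lerD (Nb v) (Nb (v *m JX x)).
rewrite -(bil_congr (JX x) (metric x)) JX_isometry; lra.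
Qed.

(** Here jY is at a value in ]-oo, e], with e so small that xi(-2e) and the
    error due to the second fundamental form are dominated by the values of xi
    and f at -c, on which jX provides information. Either the gradient of phi
    exceeds xi(-2e), or it is short enough for the error term to be
    controlled. *)
Lemma jet_transfer (x : X) (phi : Y -> R) (jX : jet X) (jY : jet Y) c e :
  C2_near phi (sigma x) ->
  jpt jX = x -> jgrad jX = gradient (phi \o sigma) x ->
  jhess jX = hessian (phi \o sigma) x ->
  jpt jY = sigma x -> jgrad jY = gradient phi (sigma x) ->
  jhess jY = hessian phi (sigma x) ->
  c < jval jX -> 0 < e -> jval jY <= e ->
  0 <= xi (- (2 * e)) -> xi (- (2 * e)) < xi (- c) ->
  f (- c) + k.+1%:R * (C * xi (- (2 * e))) < f (- e) ->
  (dirichlet_dual (F_twisted JX b k.+1 f) `|` dirichlet_dual (E_xi X xi)) jX ->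
  (dirichlet_dual (F_twisted JY b k.+1 f) `|` dirichlet_dual (E_xi Y xi)) jY.
Proof.
move=> C2phi xE pX hX yE pY hY cj e0 je xi0 xie fe [FX|EX]; last first.
  right; apply: (@E_xi_dual_intro _ _ _ _ (2 * e)) => //; first by lra.
  apply: lt_le_trans xie _; apply: le_trans (E_xi_dualP xi_homo EX cj) _.
  by rewrite xE pX yE pY pullback_gradient // conorm_pullback.
have [H|H] := ltP (xi (- (2 * e))) (conorm_at (jpt jY) (jgrad jY)).
  by right; apply: (@E_xi_dual_intro _ _ _ _ (2 * e)) => //; lra.
left; apply: F_twisted_dual_intro.
rewrite yE pY in H.
have := spec_pullback xi0 C2phi xE hX yE pY hY H.
have := F_twisted_dualP JX_cont k_lt_m f_homo FX cj.
have : f (- e) <= f (- jval jY) by apply: f_homo; rewrite lerN2.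
lra.
Qed.

End Transfer.

Lemma nbhs_rVP (R : realType) n (p : 'rV[R]_n) (P : set 'rV[R]_n) :
  nbhs p P <-> exists2 d, 0 < d & forall z, `|p - z| < d -> P z.
Proof.
split=> [/nbhs_normP[d d0 dP]|[d d0 dP]]; first by exists d.
apply: (iffRL (@nbhs_ballP R 'rV[R]_n p P)); exists d => // z.
by rewrite mx_norm_ball; exact: dP.
Qed.

(** * Topology of manifolds and proper maps *)

Section ManifoldTopology.
Context {R : realType} {n : nat} (M : manifold R n).

Lemma manifold_compact_nbhs (y : M) : exists2 K : set M, compact K & nbhs y K.
Proof.
set b := chart_at y; have by0 := chart_at_dom y.
have bz : ccod b (cmap b y) by exact: ccod_cmap.
have [d d0 Hd] := (nbhs_rVP _ _).1 (ccod_near bz).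
pose B : set 'rV[R]_n := [set z | `|cmap b y - z| <= d / 2].
have Bc : B `<=` ccod b.
  by move=> z zB; apply: Hd; apply: le_lt_trans zB _; lra.
have cB : compact B.
  apply: bounded_closed_compact.
    exists (`|cmap b y| + d / 2); split=> [|K KM z zB]; first exact: num_real.
    apply: le_trans (ltW KM); rewrite -[z](subKr (cmap b y)).
    by apply: le_trans (ler_normB _ _) _; rewrite lerD2l.
  have -> : B = closed_ball (cmap b y) (d / 2) by rewrite closed_ballE //
    divr_gt0.
  exact: closed_ball_closed.
exists (cinv b @` B).
  apply: continuous_compact => //; apply: continuous_in_subspaceT => z.
  by rewrite inE => /Bc; exact: cinv_cont.
have N1 := open_nbhs_nbhs (conj (cdom_open b) by0).
have N2 : \forall x \near y, B (cmap b x).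
  have NB : nbhs (cmap b y) B.
    apply/nbhs_rVP; exists (d / 2); first by rewrite divr_gt0.
    by move=> z /= /ltW.
  exact: (cmap_cont by0 NB).
by apply: filterS2 N1 N2 => x bx Bx; exists (cmap b x) => //; rewrite cmapK.
Qed.

(** In positive dimension, a chart provides points different from p and
    arbitrarily close to it. *)
Lemma manifold_not_isolated (p : M) : (0 < n)%N -> closure (~` [set p]) =
  [set: M].
Proof.
move=> n0; apply/seteqP; split => // q _ N Nq.
have [qp|qp] := EM (q = p); last by exists q; split; [|exact: nbhs_singleton].
rewrite {}qp in Nq.
set b := chart_at p; have bp := chart_at_dom p.
have bz : ccod b (cmap b p) by exact: ccod_cmap.
have N1 := ccod_near bz.
have N2 : \forall z \near cmap b p, N (cinv b z).
  have NN : nbhs (cinv b (cmap b p)) N by rewrite cmapK.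
  exact: (cinv_cont bz NN).
have [d d0 Hd] := (nbhs_rVP _ _).1 (filterI N1 N2).
(* A displacement shorter than the radius d. *)
pose v : 'rV[R]_n := const_mx (d / 2).
have nv : `|v| <= d / 2.
  by apply: mx_norm_le => [|i j]; rewrite ?mxE ?ger0_norm // divr_ge0 // ltW.
have [/ccodP[bq qK] Nq'] : ccod b (cmap b p + v) /\ N (cinv b (cmap b p + v)).
  by apply: Hd; rewrite opprD addrA subrr sub0r normrN;
    apply: le_lt_trans nv _; lra.
exists (cinv b (cmap b p + v)); split => // E.
move: qK; rewrite E => /eqP; rewrite -subr_eq0 opprD addrA subrr sub0r oppr_eq0.
move=> /eqP/rowP/(_ (Ordinal n0))/eqP; rewrite !mxE; apply/negP.
by rewrite gt_eqF // divr_gt0.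
Qed.

End ManifoldTopology.

(** Y is locally compact: near a given point, the image of C is that of the
    intersection of C with a compact set. *)
Lemma proper_map_closed (R : realType) m n (X : manifold R m) (Y : manifold R n)
    (sigma : X -> Y) (C : set X) :
  proper_map sigma -> continuous sigma -> closed C -> closed (sigma @` C).
Proof.
move=> prop cont cC y cly.
have [K cK Ky] := manifold_compact_nbhs y.
have cCK : compact (sigma @` (C `&` sigma @^-1` K)).
  apply: continuous_compact; first exact: continuous_subspaceT.
  by rewrite setIC; apply: compact_closedI => //; exact: prop.
have := compact_closed (@m_hausdorff _ _ Y) cCK.
move=> /(_ y) [|x [Cx _] <-]; last by exists x.
move=> N Ny; have [_ [[x Cx <-] [Nx Kx]]] := cly _ (filterI Ny Ky).
by exists (sigma x); split => //; exists x.
Qed.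

(** * Push-forward of a function along a proper map *)

Section PushForward.
Context {R : realType} {m n : nat}.
Variables (X : manifold R m) (Y : manifold R n) (sigma : X -> Y).
Hypotheses (prop : proper_map sigma) (cont : continuous sigma).
Variables (U : set X) (u : X -> \bar R) (c s : R).
Hypothesis open_U : open U.
Hypothesis usc_u : forall x, closure U x ->
  forall t : R, (u x < t%:E)%E -> \forall y \near within (closure U) (nbhs x),
    (u y < t%:E)%E.
Hypothesis boundary_u : forall x, closure U x -> ~ U x -> (u x < c%:E)%E.
Hypothesis bound_u : forall x, closure U x -> (u x <= s%:E)%E.
Hypothesis c_le_s : c <= s.

Definition fiber_sup (y : Y) : \bar R :=
  ereal_sup (0%E |` [set (u x - c%:E)%E | x in U `&` sigma @^-1` [set y]]).

Definition superlevel (t : R) : set X := [set x | U x /\ ((c + t)%:E <= u x)%E].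

(** The values of u at the boundary of U stay below c, so that limit points of a
    superlevel set are in U. *)
Lemma superlevel_closed t : 0 <= t -> closed (superlevel t).
Proof.
move=> t0 x clx.
have clUx : closure U x by apply: closure_subset clx => y [].
have ux : ((c + t)%:E <= u x)%E.
  rewrite leNgt; apply/negP => /(usc_u clUx) N.
  have [y [[Uy uy] /= H]] := clx _ N.
  by have := H (subset_closure Uy); rewrite ltNge uy.
split=> //; apply: contrapT => nUx.
have := lt_le_trans (boundary_u clUx nUx) (lexx _).
by rewrite ltNge; apply/negP; rewrite negbK; apply: le_trans ux;
  rewrite lee_fin lerDl.
Qed.

Lemma fiber_sup_ge0 y : (0 <= fiber_sup y)%E.
Proof. by apply: ereal_sup_ubound; left. Qed.

Lemma fiber_sup_ub x : U x -> (u x - c%:E <= fiber_sup (sigma x))%E.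
Proof. by move=> Ux; apply: ereal_sup_ubound; right; exists x. Qed.

Lemma fiber_sup_le y : (fiber_sup y <= (s - c)%:E)%E.
Proof.
apply: ge_ereal_sup => _ [->|[x [Ux _] <-]]; first by rewrite lee_fin subr_ge0.
by rewrite EFinB leeB //; apply: bound_u; exact: subset_closure.
Qed.

(** The points of the fibre at which u is large generate a filter on a compact
    set, as sigma is proper; a cluster point lies in all the closed superlevel
    sets below the supremum. *)
Lemma fiber_sup_attained y : (0 < fiber_sup y)%E -> exists r x,
  [/\ 0 < r, fiber_sup y = r%:E, U x, sigma x = y & u x = (r + c)%:E].
Proof.
move=> py0.
have half (q : R) : 0 < q -> 0 < q / 2 < q by move=> q0; apply/andP; split; lra.
have [r pr] : exists r, fiber_sup y = r%:E.
  case: (fiber_sup y) (fiber_sup_le y) (py0) => [r _ _|//|//]; by exists r.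
have r0 : 0 < r by move: py0; rewrite pr lte_fin.
have approx t : 0 < t < r -> exists x,
  [/\ U x, sigma x = y & ((c + t)%:E <= u x)%E].
  move=> /andP[t0 tr].
  have : (t%:E < fiber_sup y)%E by rewrite pr lte_fin.
  move=> /ereal_sup_gt[_ [->|[x [Ux xy] <-]]];
    first by rewrite lte_fin ltNge (ltW t0).
  move=> tu; exists x; split => //.
  by rewrite EFinD addeC -leeBrDr // ltW.
pose I := [set t : R | 0 < t < r].
pose B t := [set x | [/\ U x, sigma x = y & ((c + t)%:E <= u x)%E]].
have PF : ProperFilter (filter_from I B).
  apply: filter_from_proper; last by move=> t /approx[x]; exists x.
  apply: filter_from_filter.
    by exists (r / 2); exact: half.
  move=> t1 t2 /andP[t10 t1r] /andP[t20 t2r]; exists (Num.max t1 t2).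
    by rewrite /I /= lt_max t10 /= gt_max t1r.
  move=> x [Ux xy ux]; split; split => //; apply: le_trans ux;
  by rewrite lee_fin lerD2l le_max lexx ?orbT.
have FK : filter_from I B (sigma @^-1` [set y]).
  by exists (r / 2); [exact: half|move=> x []].
have [x [xy clx]] := prop (@compact_set1 _ y) PF FK.
have inC t : 0 < t < r -> superlevel t x.
  move=> tr; have t0 : 0 <= t by case/andP: tr => /ltW.
  apply: (superlevel_closed t0) => N Nx.
  have FB : filter_from I B (B t) by exists t.
  by have [z [[Uz _ uz] Nz]] := clx _ _ FB Nx; exists z.
have [Ux _] : superlevel (r / 2) x.
  by apply: inC; exact: half.
exists r, x; split => //; apply/eqP; rewrite eq_le; apply/andP; split.
  by have := fiber_sup_ub Ux; rewrite xy pr leeBlDr // -EFinD.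
rewrite leNgt; apply/negP => H.
have [a ua] : exists a, u x = a%:E.
  have : ((c + r / 2)%:E <= u x)%E.
    by case: (inC (r / 2)) => //; exact: half.
  by case: (u x) H => [a _ _|//|//]; exists a.
rewrite ua lte_fin in H.
have ca : c + r / 2 <= a.
  by have [_] := inC (r / 2) (half r r0); rewrite ua lee_fin.
(* If a - c < r, the level halfway between them is not reached at x. *)
have mid : 0 < (a - c + r) / 2 < r by apply/andP; split; lra.
have [_] := inC _ mid.
by rewrite ua lee_fin; lra.
Qed.

(** The superlevel sets of fiber_sup at positive levels are the images under
    sigma of those of u, closed since sigma is proper. *)
Lemma fiber_sup_usc y (t : R) : (fiber_sup y < t%:E)%E -> \forall z \near y,
  (fiber_sup z < t%:E)%E.
Proof.
move=> pt; have t0 : 0 < t by rewrite -lte_fin;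
  exact: le_lt_trans (fiber_sup_ge0 y) pt.
have cS := proper_map_closed prop cont (superlevel_closed (ltW t0)).
have : (~` (sigma @` superlevel t)) y.
  move=> [x [Ux ux] xy]; move: pt; rewrite ltNge => /negP; apply.
  apply: le_trans (_ : _ <= u x - c%:E)%E _; last by rewrite -xy fiber_sup_ub.
  by rewrite leeBrDr // -EFinD addrC.
move=> ny; have := open_nbhs_nbhs (conj (closed_openC cS) ny).
apply: filterS => z nz; have [p0|] := ltP 0%E (fiber_sup z); last first.
  by move=> /le_lt_trans; apply; rewrite lte_fin.
have [r [x [r0 -> Ux xz ux]]] := fiber_sup_attained p0.
rewrite ltNge; apply/negP => tr; apply: nz; exists x => //; split => //.
by rewrite ux lee_fin addrC lerD2r.
Qed.

End PushForward.

(** * The Ahlfors property *)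

Section Ahlfors.
Context {R : realType}.

(** The complement of p is an open set with boundary {p}, and its closure is the
    whole manifold, so that the Ahlfors property bounds a global subsolution by
    its value at p. With p and q exchanged, such a function is constant. *)
Lemma ahlfors_global_constant n (Y : riemannian R n) (H : set (jet Y))
  (v : Y -> \bar R) (B : R) p q :
  (0 < n)%N -> ahlfors H ->
  (forall y, (0 <= v y)%E) -> (forall y, (v y <= B%:E)%E) ->
  (forall y (t : R), (v y < t%:E)%E -> \forall z \near y, (v z < t%:E)%E) ->
  (forall y phi, is_test v y phi ->
     exists2 j, (H `|` [set j | jval j <= 0]) j & is_jet2 phi y j) ->
  (v q <= v p)%E.
Proof.
move=> n0 aH v0 vB usc sub; rewrite leNgt; apply/negP => pq.
have clV := @manifold_not_isolated _ _ Y p n0.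
have uscv Z : usc_on Z v.
  move=> y _; split; first exact: le_lt_trans (vB y) (ltry _).
  by move=> t yt; apply: cvg_within; exact: usc.
have bV : closure (~` [set p]) `\` ~` [set p] = [set p].
  by rewrite clV setTD setCK.
have := @aH (~` [set p]); rewrite bV => /(_ _ _ v) E.
have := E _ _ _ _ _; rewrite clV => {}E.
have : ereal_sup [set maxe (v x) 0%E | x in [set p]] =
  ereal_sup [set v x | x in [set: Y]].
  apply: E.
  - by apply: closed_openC; apply: compact_closed;
      [exact: m_hausdorff|exact: compact_set1].
  - by exists p.
  - split; first exact: uscv.
    by split; [exact: uscv|move=> y _ phi; exact: sub].
  - by exists B => y _; exact: vB.
  - by exists q => //; exact: le_lt_trans (v0 p) pq.
rewrite image_set1 ereal_sup1 max_l // => vp.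
have : (v q <= v p)%E by rewrite vp; apply: ereal_sup_ubound; exists q.
by rewrite leNgt pq.
Qed.

End Ahlfors.

Section AhlforsPullback.
Context {R : realType} {m n : nat}.
Variables (X : riemannian R m) (Y : riemannian R n) (sigma : X -> Y).
Variables (JX : X -> 'M[R]_m) (JY : Y -> 'M[R]_n).
Variables (b : spectral_kind) (k : nat) (f xi : R -> R).

(** As f and xi vanish at 0 while f(-c0) < 0 < xi(-c0), all the conditions hold
    near e = 0 by continuity. *)
Lemma small_constants C c0 d : 0 < c0 -> 0 < d -> cond_f1 f -> cond_xi1 xi ->
  exists e, [/\ 0 < e, e <= d, 0 < xi (- (2 * e)), xi (- (2 * e)) < xi (- c0) &
    f (- c0) + k.+1%:R * (C * xi (- (2 * e))) < f (- e)].
Proof.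
move=> c00 d0 [fc fm f0 fneg] [xic xim xi0 xipos].
pose h1 (e : R) : R := xi (- (2 * e)); pose h2 (e : R) : R :=
  f (- e) - (k.+1%:R * C) * xi (- (2 * e)).
have opc (a : R) : {for 0, continuous (fun e : R => - (a * e))}.
  apply: continuousN; apply: continuous_atM; first exact: continuous_at_cst.
  exact: cvg_id.
have comp (g : R -> R) (a : R) : continuous g ->
    {for 0, continuous (fun e : R => g (- (a * e)))}.
  by move=> gc; exact: (continuous_comp (opc a) (gc _)).
have c1 : {for 0, continuous h1} by exact: comp xic.
have c2 : {for 0, continuous h2}.
  rewrite (_ : h2 = fun e => f (- (1 * e)) + (- (k.+1%:R * C)) * h1 e);
    last first.
    by apply/funext => e; rewrite /h2 mul1r mulNr.
  apply: continuous_atD.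
    exact: comp fc.
  by apply: continuous_atM => //; exact: continuous_at_cst.
have h10 : h1 0 < xi (- c0) by rewrite /h1 mulr0 oppr0 xi0 xipos // oppr_lt0.
have h20 : f (- c0) < h2 0 by rewrite /h2 mulr0 oppr0 xi0 f0 mulr0 subr0 fneg
  // oppr_lt0.
have N1 : \forall e \near (0 : R), h1 e < xi (- c0).
  exact: c1 _ (open_nbhs_nbhs (conj (@open_lt R _) h10)).
have N2 : \forall e \near (0 : R), f (- c0) < h2 e.
  exact: c2 _ (open_nbhs_nbhs (conj (@open_gt R _) h20)).
have [r /= r0 Hr] := iffLR (@nbhs_ballP R R 0 _) (filterI N1 N2).
pose e := Num.min (r / 2) d.
have e0 : 0 < e by rewrite lt_min divr_gt0.
have er : e <= r / 2 by rewrite ge_min lexx.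
have [|H1 H2] := Hr e; first by rewrite /ball /= sub0r normrN gtr0_norm //; lra.
exists e; split => //; first by rewrite ge_min lexx orbT.
  by apply: xipos; lra.
by rewrite mulrA -ltrBrDr.
Qed.

Hypothesis imm : isometric_immersion sigma.
Hypothesis prop : proper_map sigma.
Hypothesis bdd : bounded_second_fundamental_form sigma.
Hypothesis JX_isometry : forall x, JX x *m metric x *m (JX x)^T = metric x.
Hypothesis JX_cont : forall a, atlas a -> forall y, ccod a y ->
  {for y, continuous (endo_in_chart JX a)}.
Hypothesis JY_cont : forall a, atlas a -> forall y, ccod a y ->
  {for y, continuous (endo_in_chart JY a)}.
Hypothesis JD : forall x,
  JX x *m differential sigma x = differential sigma x *m JY (sigma x).
Hypotheses (k_lt_m : (k < m)%N) (f_f1 : cond_f1 f) (xi_xi1 : cond_xi1 xi).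

Theorem ahlfors_pullback :
  ahlfors (dirichlet_dual (F_twisted JY b k.+1 f)
    `|` dirichlet_dual (E_xi Y xi)) ->
  ahlfors (dirichlet_dual (F_twisted JX b k.+1 f)
    `|` dirichlet_dual (E_xi X xi)).
Proof.
move=> aY; set GX := _ `|` _; set GY := _ `|` _ in aY.
have [fc fm f0 fneg] := f_f1; have [xic xim xi0 xipos] := xi_xi1.
have [C C0 bC] : exists2 C, 0 <= C & forall (x : X) v w,
    norm_at (sigma x) (second_fundamental_form sigma x v w)
      <= C * norm_at x v * norm_at x w.
  have [C bC] := bdd; exists `|C|; first exact: normr_ge0.
  move=> x v w; apply: le_trans (bC x v w) _; rewrite -!mulrA ler_wpM2r //.
    by rewrite mulr_ge0 // sqrtr_ge0.
  exact: ler_norm.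
have cont : continuous sigma by case: imm => -[].
move=> /= U oU [x0 bx0] u [uscu [_ subu]] [B uB] [x1 clx1 ux1].
set sb := ereal_sup _; set su := ereal_sup _.
have su_ub x : closure U x -> (u x <= su)%E.
  by move=> clx; apply: ereal_sup_ubound; exists x.
apply/eqP; rewrite eq_le; apply/andP; split.
  apply: ge_ereal_sup => _ [x [clx _] <-].
  by rewrite ge_max su_ub //= (le_trans (ltW ux1)) // su_ub.
rewrite leNgt; apply/negP => sbsu.
have suB : (su <= B%:E)%E by apply: ge_ereal_sup => _ [x clx <-]; exact: uB.
have sb_ub x : closure U x -> ~ U x -> (u x <= sb)%E.
  move=> clx nUx; apply: le_trans (_ : maxe (u x) 0 <= _)%E;
    first by rewrite le_max lexx.
  by apply: ereal_sup_ubound; exists x.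
have sb0 : (0 <= sb)%E.
  apply: le_trans (_ : maxe (u x0) 0 <= _)%E; first by rewrite le_max lexx orbT.
  by apply: ereal_sup_ubound; exists x0.
have [s sE] : exists s, su = s%:E.
  by move: suB (le_lt_trans sb0 sbsu); case: (su) => [s _ _|//|//]; exists s.
have [s' s'E] : exists s', sb = s'%:E.
  move: sb0 sbsu; rewrite sE; case: (sb) => [s' _ _|//|//]; by exists s'.
rewrite sE s'E lte_fin in sbsu; rewrite s'E lee_fin in sb0.
(* c0 separates the boundary values from the supremum; the constants that the
   jets on X provide depend on c0 only, not on e. *)
pose c0 := (s' + s) / 2.
have c00 : 0 < c0 by rewrite /c0; lra.
have c0s : 0 < s - c0 by rewrite /c0; lra.
have [e [e0 ed xie0 xie fe]] := small_constants C c00 c0s f_f1 xi_xi1.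
pose c := s - e; have c0c : c0 <= c by rewrite /c; lra.
have cs : c <= s by rewrite /c; lra.
have s'c : s' < c by apply: lt_le_trans c0c; rewrite /c0; lra.
have bdu x : closure U x -> ~ U x -> (u x < c%:E)%E.
  by move=> clx nUx; apply: le_lt_trans (sb_ub x clx nUx) _;
    rewrite s'E lte_fin.
have ubu x : closure U x -> (u x <= s%:E)%E by rewrite -sE; exact: su_ub.
have uscU x : closure U x -> forall t : R, (u x < t%:E)%E ->
    \forall y \near within (closure U) (nbhs x), (u y < t%:E)%E.
  by move=> clx t; have [_] := uscu x clx; apply.
pose v := fiber_sup sigma U u c.
have v0 y : (0 <= v y)%E by exact: fiber_sup_ge0.
have vle y : (v y <= e%:E)%E.
  by have := fiber_sup_le sigma ubu cs y; rewrite (_ : s - c = e) // /c; lra.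
have vusc y (t : R) : (v y < t%:E)%E -> \forall z \near y, (v z < t%:E)%E.
  exact: (fiber_sup_usc prop cont uscU bdu ubu cs).
have vsub y phi : is_test v y phi ->
    exists2 j, (GY `|` [set j | jval j <= 0]) j & is_jet2 phi y j.
  move=> [C2phi vphi phiv].
  pose jY := Jet y (phi y) (gradient phi y) (hessian_sym C2phi).
  exists jY; last by split.
  have [p0|p0] := leP (phi y) 0; first by right.
  have vy0 : (0 < v y)%E by rewrite -phiv lte_fin.
  have [r [x [r0 vr Ux xy ux]]] := fiber_sup_attained prop uscU bdu ubu cs vy0.
  left.
  have rphi : phi y = r by apply: EFin_inj; rewrite phiv.
  (* v o sigma >= u - c near x, with equality at x. *)
  pose psi x' := (phi \o sigma) x' + c.
  have C2s : C2_near phi (sigma x) by rewrite xy.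
  have C2psi : C2_near psi x.
    by apply: C2_near_addc; apply: pullback_C2_near => //; case: imm.
  have tpsi : is_test u x psi.
    split => //; last by rewrite /psi /= xy rphi ux.
    have N1 := open_nbhs_nbhs (conj oU Ux).
    have N2 : \forall x' \near x, (v (sigma x') <= (phi (sigma x'))%:E)%E.
      by rewrite -xy in vphi; exact: (cont _ _ vphi).
    apply: filterS2 N1 N2 => x' Ux' vx'; rewrite /psi EFinD -leeBlDr //.
    exact: le_trans (fiber_sup_ub sigma u c Ux') vx'.
  have Ux_int : (closure U)° x.
    by apply: filterS (open_nbhs_nbhs (conj oU Ux)); exact: subset_closure.
  have [jX HX [jx jv jg jh]] := subu x Ux_int psi tpsi.
  have jvE : jval jX = r + c by rewrite jv /psi /= xy rphi.
  rewrite gradient_addc in jg; rewrite hessian_addc in jh.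
  case: HX => [HX|]; last by rewrite /= jvE => H; exfalso; lra.
  have jYx : jpt jY = sigma x by rewrite xy.
  have jYg : jgrad jY = gradient phi (sigma x) by rewrite xy.
  have jYh : jhess jY = hessian phi (sigma x) by rewrite xy.
  have jXc : c0 < jval jX by rewrite jvE; lra.
  have jYe : jval jY <= e by rewrite -lee_fin /= phiv; exact: vle.
  exact: (jet_transfer imm C0 bC JX_isometry JX_cont JD k_lt_m fm xim C2s jx jg
    jh jYx jYg jYh jXc e0 jYe (ltW xie0) xie fe HX).
have [x2 [Ux2 ux2]] : exists x, U x /\ (c%:E < u x)%E.
  have : (c%:E < su)%E by rewrite sE lte_fin /c; lra.
  move=> /ereal_sup_gt[_ [x clx <-] cux]; exists x; split => //.
  by apply: contrapT => nUx; have := lt_trans cux (bdu x clx nUx); rewrite ltxx.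
have vx2 : (0 < v (sigma x2))%E.
  apply: lt_le_trans (fiber_sup_ub sigma u c Ux2).
  by rewrite sube_gt0.
have n0 : (0 < n)%N.
  have [_ /(_ x2) Df _] := imm.
  by rewrite (leq_ltn_trans (leq0n k)) // (leq_trans k_lt_m) // -(eqP Df)
    rank_leq_col.
have kn : (k < n)%N.
  have [_ /(_ x2) Df _] := imm.
  by rewrite (leq_trans k_lt_m) // -(eqP Df) rank_leq_col.
have [r [x [r0 vr _ _ _]]] := fiber_sup_attained prop uscU bdu ubu cs vx2.
(* The constant v is its own test function; its jet has zero gradient and zero
   Hessian, and a positive value. *)
have vcst y : v y = r%:E.
  rewrite -vr; apply/eqP; rewrite eq_le; apply/andP; split;
  exact: (ahlfors_global_constant _ _ n0 aY v0 vle vusc vsub).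
have [|j Hj [jy jv jg jh]] := vsub (sigma x2) (fun=> r).
  by split; [exact: C2_near_cst|apply: filterE => y; rewrite vcst|rewrite vcst].
have r2j : r / 2 < jval j by rewrite jv; lra.
case: Hj => [[Fj|Ej]|]; last by rewrite /= jv leNgt r0.
- have := F_twisted_dualP JY_cont kn fm Fj r2j.
  rewrite leNgt => /negP; apply; rewrite /spec_at.
  apply: spectral_cert_sound => //; first exact: metric_posdef.
    by apply: hermitian_part_sym; exact: jhess_sym.
  rewrite /= jh hessian_cst hermitian_partN (_ : hermitian_part _ 0 = 0).
    by rewrite oppr0; apply: spectral_cert_zero;
      [exact: metric_posdef|apply: fneg; lra].
  by rewrite /hermitian_part mulmx0 mul0mx addr0 scaler0.
- have := E_xi_dualP xim Ej r2j.
  rewrite jg gradient_cst /conorm_at bil0l sqrtr0 leNgt xipos //; lra.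
Qed.

End AhlforsPullback.

Lemma F_real_twisted (R : realType) n (M : riemannian R n) b k f :
  F_real M b k f = F_twisted (fun _ : M => 1%:M) b k f.
Proof.
by apply/seteqP; split => j;
  rewrite /F_real /F_twisted /spec_at /= hermitian_part1.
Qed.

Lemma endo_in_chart1 (R : realType) n (M : riemannian R n) (a : chart R M n) :
  atlas a -> forall y, ccod a y ->
  {for y, continuous (endo_in_chart (fun _ : M => 1%:M) a)}.
Proof.
move=> aa y ay.
apply: (near_eq_continuous_at (f := fun=> 1%:M)); last exact: continuous_at_cst.
apply: filterS (ccod_near ay) => z /ccodP[az _].
by rewrite /endo_in_chart mulmx1 mulmxV // to_preferred_unit.
Qed.

Theorem theorem7p1 (R : realType) (m n k : nat) (b : spectral_kind)
    (f xi : R -> R) (k_gt0 : (0 < k)%N) (k_le_m : (k <= m)%N)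
    (f_f1 : cond_f1 f) (xi_xi1 : cond_xi1 xi) :
  (forall (X : riemannian R m) (Y : riemannian R n) (sigma : X -> Y),
     proper_map sigma -> isometric_immersion sigma ->
     bounded_second_fundamental_form sigma ->
     ahlfors (dirichlet_dual (F_real Y b k f)
              `|` dirichlet_dual (E_xi Y xi)) ->
     ahlfors (dirichlet_dual (F_real X b k f)
              `|` dirichlet_dual (E_xi X xi))) /\
  (forall (X : almost_hermitian R m) (Y : almost_hermitian R n)
          (sigma : X -> Y),
     proper_map sigma -> isometric_immersion sigma ->
     almost_complex_map sigma ->
     bounded_second_fundamental_form sigma ->
     ahlfors (dirichlet_dual (F_complex Y b k f)
              `|` dirichlet_dual (E_xi Y xi)) ->
     ahlfors (dirichlet_dual (F_complex X b k f)
              `|` dirichlet_dual (E_xi X xi))).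
Proof.
case: k k_gt0 k_le_m => // k _ km; split.
  move=> X Y sigma prop imm bdd; rewrite !F_real_twisted.
  apply: (@ahlfors_pullback R m n X Y sigma (fun=> 1%:M) (fun=> 1%:M) b k f xi
            imm prop bdd _ _ _ _ km f_f1 xi_xi1).
  - by move=> x; rewrite mul1mx trmx1 mulmx1.
  - exact: endo_in_chart1.
  - exact: endo_in_chart1.
  - by move=> x; rewrite mul1mx mulmx1.
move=> X Y sigma prop imm acm bdd.
apply: (@ahlfors_pullback R m n X Y sigma (@acs R m X) (@acs R n Y) b k f xi
          imm prop bdd _ _ _ acm km f_f1 xi_xi1).
- exact: acs_isometry.
- by move=> a aa y ay; have [ec _] := acs_smooth aa 0; exact: ec.
- by move=> a aa y ay; have [ec _] := acs_smooth aa 0; exact: ec.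
Qed.
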